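(* Let $\mathrm{L}=\mathcal R\cup\mathcal D$ be a set-sized relational $\omega$-signature, $\mathcal C$ an infinite set of constants disjoint from $\mathrm{L}$, and $S$ a set which is a consistency property all of whose elements are finite sets of $\mathrm{L}(\mathcal C)_{\infty\omega}$-sentences. Let $F$ be a $V$-generic filter for $\mathbb P_S$. Then in $V[F]$: (1) the domain of $\mathcal A_F$ is exactly $\{[c]_F:c\in\mathcal C\}$; (2) for every $\mathrm{L}(\mathcal C)_{\infty\omega}$-sentence $\psi$, if $\psi\in\Sigma_F$ then $\mathcal A_F\models\psi$.
   Context: A relational $\omega$-signature $\mathrm{L}=\mathcal R\cup\mathcal D$ has finitary relation symbols $\mathcal R$ and constants $\mathcal D$; $\mathrm{L}(\mathcal C)$ adds the constants of $\mathcal C$. $\mathrm{L}_{\infty\omega}$-formulae are built from atomic formulae by $\neg$, set-sized $\bigwedge,\bigvee$ (with finitely many free variables jointly) and finite quantification $\forall V,\exists V$. Define $\phi\neg$: $\neg\phi$ for atomic $\phi$; $(\neg\chi)\neg=\chi$; $(\bigwedge\Phi)\neg=\bigvee\{\neg\chi:\chi\in\Phi\}$; $(\bigvee\Phi)\neg=\bigwedge\{\neg\chi:\chi\in\Phi\}$; $(\forall\bar v\chi)\neg=\exists\bar v\neg\chi$; $(\exists\bar v\chi)\neg=\forall\bar v\neg\chi$. A set $S$ of sets of $\mathrm{L}(\mathcal C)_{\infty\omega}$-sentences is a consistency property if for every $s\in S$: (Con) no $r\in S$ contains both $\phi$ and $\neg\phi$; (Ind.1) $\neg\phi\in s\Rightarrow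 s\cup\{\phi\neg\}\in S$; (Ind.2) $\bigwedge\Phi\in s\Rightarrow s\cup\{\phi\}\in S$ for all $\phi\in\Phi$; (Ind.3) $\forall\bar v\phi(\bar v)\in s\Rightarrow s\cup\{\phi(\bar c)\}\in S$ for all $\bar c\in(\mathcal C\cup\mathcal D)^{|\bar v|}$; (Ind.4) $\bigvee\Phi\in s\Rightarrow s\cup\{\phi\}\in S$ for some $\phi\in\Phi$; (Ind.5) $\exists\bar v\phi(\bar v)\in s\Rightarrow s\cup\{\phi(\bar c)\}\in S$ for some $\bar c\in\mathcal C^{|\bar v|}$; (Str.1) for $c,d\in\mathcal C\cup\mathcal D$, $c=d\in s\Rightarrow s\cup\{d=c\}\in S$; (Str.2) for $c,d\in\mathcal C\cup\mathcal D$, $\{c=d,\phi(d)\}\subseteq s\Rightarrow s\cup\{\phi(c)\}\in S$; (Str.3) for $d\in\mathcal C\cup\mathcal D$ there is $c\in\mathcal C$ with $s\cup\{c=d\}\in S$. $\mathbb P_S$: conditions are sets $s$ of sentences contained in some element of $S$, ordered by $p\le q$ iff $q\subseteq p$. For a filter $F$, $\Sigma_F=\bigcup F$, and $\mathcal A_F$ is the Tarski $\mathrm{L}(\mathcal C)$-structure with domain the classes $[e]_F$ of $\mathcal C\cup\mathcal D$ under $c\cong_F d\iff (c=d)\in\Sigma_F$, $R^{\mathcal A_F}([c_1]_F,\dots,[c_n]_F)$ iff $R(c_1,\dots,c_n)\in\Sigma_F$, and each constant $d$ interpreted as $[d]_F$. *)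

(* Defs.v *)
From Stdlib Require Import ClassicalEpsilon.
From mathcomp Require Import all_boot.
From mathcomp Require Import boolp classical_sets functions cardinality.

Set Implicit Arguments.
Unset Strict Implicit.
Unset Printing Implicit Defensive.

Local Open Scope classical_set_scope.

(** The type-theoretic universe plays the role of V[F], the universe in which
    the generic filter lives.  The ground model V is a well-founded
    extensional model of ZFC in it, that is, up to its Mostowski collapse, a
    transitive model. *)

(* First-order formulae of the language of set theory, with variables
   indexed by nat; they are only used to state the two axiom schemata. *)
Inductive stform : Type :=
| STmem of nat & nat
| STeq of nat & nat
| STneg of stform
| STand of stform & stform
| STall of nat & stform.

Definition upd (T : Type) (e : nat -> T) (i : nat) (x : T) : nat -> T :=
  fun j => if j == i then x else e j.

Fixpoint stsat (T : Type) (E : T -> T -> Prop) (e : nat -> T) (f : stform) :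
    Prop :=
  match f with
  | STmem i j => E (e i) (e j)
  | STeq i j => e i = e j
  | STneg g => ~ stsat E e g
  | STand g h => stsat E e g /\ stsat E e h
  | STall i g => forall x, stsat E (upd e i x) g
  end.

Record ZFC (T : Type) (E : T -> T -> Prop) : Prop := {
  zfc_extensionality : forall x y, (forall z, E z x <-> E z y) -> x = y;
  zfc_foundation : forall x, (exists y, E y x) ->
    exists y, E y x /\ forall z, E z x -> ~ E z y;
  zfc_pairing : forall x y, exists z, forall w, E w z <-> w = x \/ w = y;
  zfc_union : forall x, exists y, forall z,
    E z y <-> exists w, E w x /\ E z w;
  zfc_powerset : forall x, exists y, forall z,
    E z y <-> forall w, E w z -> E w x;
  zfc_infinity : exists w,
    (exists x, E x w /\ forall z, ~ E z x) /\
    (forall x, E x w ->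
       exists y, E y w /\ forall z, E z y <-> E z x \/ z = x);
  (* the variables other than 0 (resp. 0 and 1) of f are the parameters *)
  zfc_separation : forall (f : stform) (e : nat -> T) a, exists b, forall x,
    E x b <-> E x a /\ stsat E (upd e 0 x) f;
  zfc_replacement : forall (f : stform) (e : nat -> T) a,
    (forall x, E x a -> exists! y, stsat E (upd (upd e 0 x) 1 y) f) ->
    exists b, forall y,
      E y b <-> exists x, E x a /\ stsat E (upd (upd e 0 x) 1 y) f;
  zfc_choice : forall a,
    (forall x, E x a -> exists z, E z x) ->
    (forall x y z, E x a -> E y a -> E z x -> E z y -> x = y) ->
    exists c, forall x, E x a -> exists! z, E z c /\ E z x
}.

Record groundModel := GroundModel {
  gsort :> Type;
  gmem : gsort -> gsort -> Prop;
  gmem_wf : well_founded gmem;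
  gmem_zfc : ZFC gmem
}.

Notation "x ∈ y" := (gmem x y) (at level 70, no associativity).

Lemma ground_inhabited (V : groundModel) : inhabited V.
Proof. by have [w _] := zfc_infinity (gmem_zfc V); exists. Qed.

Section SetOps.
Variable V : groundModel.
Implicit Types (x y z : V) (P : set V).

Definition ext x : set V := [set z | z ∈ x].

(* The element of V with extension P; unspecified if there is none, but the
   extensions used below all are sets of V, by the axioms of ZFC. *)
Definition setof P : V :=
  epsilon (ground_inhabited V) (fun z => forall w, w ∈ z <-> P w).

Definition subs x y : Prop := ext x `<=` ext y.
Definition emp : V := setof set0.
Definition upair x y : V := setof [set w | w = x \/ w = y].
Definition opair x y : V := upair (upair x x) (upair x y).
Definition cup x y : V := setof (ext x `|` ext y).
Definition adj x y : V := setof (ext x `|` [set y]).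
Definition im (f : V -> V) x : V := setof (f @` ext x).

Fixpoint num (n : nat) : V := if n is m.+1 then adj (num m) (num m) else emp.

Definition ktag (k : nat) x : V := opair (num k) x.

End SetOps.

Arguments emp {V}.
Arguments num {V} n.

(* The arity function is an element of V, a set of pairs (R, n). *)
Record signature (V : groundModel) := Signature {
  rels : V;
  arity : V;
  csts : V;
  arity_dom : forall z, z ∈ arity ->
    exists R n, R ∈ rels /\ z = opair R (num n);
  arity_fun : forall R, R ∈ rels -> exists! n : nat, opair R (num n) ∈ arity
}.

Definition addC (V : groundModel) (L : signature V) (C : V) : signature V :=
  Signature (cup (csts L) C) (@arity_dom V L) (@arity_fun V L).

Section Syntax.
Variables (V : groundModel) (L : signature V).

Definition csym := {c : V | c ∈ csts L}.

Inductive term : Type := tvar of nat | tcst of csym.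

Definition tcode (t : term) : V :=
  match t with
  | tvar n => ktag 0 (num n)
  | tcst c => ktag 1 (sval c)
  end.

Definition seqcode (ts : seq term) : V :=
  foldr (fun t a => opair (tcode t) a) emp ts.

Definition rel_code (R : V) (ts : seq term) : V := ktag 0 (opair R (seqcode ts)).
Definition eq_code (t u : term) : V := ktag 1 (opair (tcode t) (tcode u)).
Definition neg_code (x : V) : V := ktag 2 x.
Definition and_code (X : V) : V := ktag 3 X.
Definition or_code (X : V) : V := ktag 4 X.
Definition all_code (W x : V) : V := ktag 5 (opair W x).
Definition ex_code (W x : V) : V := ktag 6 (opair W x).

(* W is a finite set of variables, the n-th variable being given by num n *)
Definition varset (W : V) : Prop :=
  exists vs : seq nat, forall z, z ∈ W <-> exists n, n \in vs /\ z = num n.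

(* Parse trees: formulae are elements of V, and preform x is the type of
   witnesses that x is one, apart from the condition on the free variables
   of conjunctions and disjunctions, which is finfree below. *)
Inductive preform : V -> Type :=
| Prel (R : V) (ts : seq term) :
    R ∈ rels L -> opair R (num (size ts)) ∈ arity L -> preform (rel_code R ts)
| Peq (t u : term) : preform (eq_code t u)
| Pneg (x : V) : preform x -> preform (neg_code x)
| Pand (X : V) : (forall x, x ∈ X -> preform x) -> preform (and_code X)
| Por (X : V) : (forall x, x ∈ X -> preform x) -> preform (or_code X)
| Pall (W x : V) : varset W -> preform x -> preform (all_code W x)
| Pex (W x : V) : varset W -> preform x -> preform (ex_code W x).

Fixpoint free (x : V) (d : preform x) : set nat :=
  match d with
  | Prel _ ts _ _ => [set n | List.In (tvar n) ts]
  | Peq t u => [set n | t = tvar n \/ u = tvar n]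
  | Pneg _ d1 => free d1
  | Pand X f => [set n | exists x (h : x ∈ X), free (f x h) n]
  | Por X f => [set n | exists x (h : x ∈ X), free (f x h) n]
  | Pall W _ _ d1 => [set n | free d1 n /\ ~ num n ∈ W]
  | Pex W _ _ d1 => [set n | free d1 n /\ ~ num n ∈ W]
  end.

Fixpoint finfree (x : V) (d : preform x) : Prop :=
  match d with
  | Prel _ _ _ _ => True
  | Peq _ _ => True
  | Pneg _ d1 => finfree d1
  | Pand X f =>
      finite_set [set n | exists x (h : x ∈ X), free (f x h) n] /\
      forall x (h : x ∈ X), finfree (f x h)
  | Por X f =>
      finite_set [set n | exists x (h : x ∈ X), free (f x h) n] /\
      forall x (h : x ∈ X), finfree (f x h)
  | Pall _ _ _ d1 => finfree d1
  | Pex _ _ _ d1 => finfree d1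
  end.

Record form := Form {
  fcode :> V;
  ftree : preform fcode;
  ffin : finfree ftree
}.

Definition fv (phi : form) : set nat := free (ftree phi).
Definition sentence (phi : form) : Prop := fv phi = set0.

Definition tsubst (s : nat -> option csym) (t : term) : term :=
  match t with
  | tvar n => if s n is Some c then tcst c else tvar n
  | tcst c => tcst c
  end.

Definition mask (W : V) (s : nat -> option csym) : nat -> option csym :=
  fun n => if `[< num n ∈ W >] then None else s n.

Fixpoint presubst (x : V) (d : preform x) (s : nat -> option csym) : V :=
  match d with
  | Prel R ts _ _ => rel_code R (map (tsubst s) ts)
  | Peq t u => eq_code (tsubst s t) (tsubst s u)
  | Pneg _ d1 => neg_code (presubst d1 s)
  | Pand X f =>
      and_code (setof [set y | exists x (h : x ∈ X), y = presubst (f x h) s])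
  | Por X f =>
      or_code (setof [set y | exists x (h : x ∈ X), y = presubst (f x h) s])
  | Pall W _ _ d1 => all_code W (presubst d1 (mask W s))
  | Pex W _ _ d1 => ex_code W (presubst d1 (mask W s))
  end.

Definition subst (phi : form) (s : nat -> option csym) : V :=
  presubst (ftree phi) s.

(* the variables in W are replaced according to c, the others are kept *)
Definition inst (W : V) (c : nat -> csym) : nat -> option csym :=
  fun n => if `[< num n ∈ W >] then Some (c n) else None.

Definition inst1 (v : nat) (c : csym) : nat -> option csym :=
  fun n => if n == v then Some c else None.

(* neg_in phi is phi¬, the formula obtained from the negation of phi by moving
   the negation inside. *)
Definition preneg_in (x : V) (d : preform x) : V :=
  match d with
  | Prel R ts _ _ => neg_code (rel_code R ts)
  | Peq t u => neg_code (eq_code t u)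
  | @Pneg y _ => y
  | Pand X _ => or_code (im neg_code X)
  | Por X _ => and_code (im neg_code X)
  | @Pall W y _ _ => ex_code W (neg_code y)
  | @Pex W y _ _ => all_code W (neg_code y)
  end.

Definition neg_in (phi : form) : V := preneg_in (ftree phi).

Record structure := Structure {
  dom : Type;
  irel : V -> seq dom -> Prop;
  icst : csym -> dom
}.

Definition teval (A : structure) (rho : nat -> dom A) (t : term) : dom A :=
  match t with
  | tvar n => rho n
  | tcst c => icst A c
  end.

Fixpoint sat (A : structure) (x : V) (d : preform x) (rho : nat -> dom A) :
    Prop :=
  match d with
  | Prel R ts _ _ => @irel A R (map (teval rho) ts)
  | Peq t u => teval rho t = teval rho u
  | Pneg _ d1 => ~ sat d1 rho
  | Pand X f => forall x (h : x ∈ X), sat (f x h) rho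
  | Por X f => exists x (h : x ∈ X), sat (f x h) rho
  | Pall W _ _ d1 => forall rho' : nat -> dom A,
      (forall n, ~ num n ∈ W -> rho' n = rho n) -> sat d1 rho'
  | Pex W _ _ d1 => exists rho' : nat -> dom A,
      (forall n, ~ num n ∈ W -> rho' n = rho n) /\ sat d1 rho'
  end.

Definition models (A : structure) (phi : form) : Prop :=
  forall rho : nat -> dom A, sat (ftree phi) rho.

End Syntax.

Section Consistency.
Variables (V : groundModel) (L : signature V) (C S : V).
Local Notation LC := (addC L C).
Local Notation eqc c d := (eq_code (tcst c) (tcst d)).

Record consistency_property : Prop := {
  cp_sentences : forall s x, s ∈ S -> x ∈ s ->
    exists phi : form LC, x = phi /\ sentence phi;
  cp_con : forall r, r ∈ S -> forall phi : form LC,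
    ~ ((phi : V) ∈ r /\ neg_code phi ∈ r);
  cp_ind1 : forall s, s ∈ S -> forall phi : form LC,
    neg_code phi ∈ s -> adj s (neg_in phi) ∈ S;
  cp_ind2 : forall s, s ∈ S -> forall Phi : V,
    and_code Phi ∈ s -> forall x, x ∈ Phi -> adj s x ∈ S;
  cp_ind3 : forall s, s ∈ S -> forall (W : V) (phi : form LC),
    all_code W phi ∈ s ->
    forall c : nat -> csym LC, adj s (subst phi (inst W c)) ∈ S;
  cp_ind4 : forall s, s ∈ S -> forall Phi : V,
    or_code Phi ∈ s -> exists x, x ∈ Phi /\ adj s x ∈ S;
  cp_ind5 : forall s, s ∈ S -> forall (W : V) (phi : form LC),
    ex_code W phi ∈ s ->
    exists c : nat -> csym LC,
      (forall n, num n ∈ W -> sval (c n) ∈ C) /\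
      adj s (subst phi (inst W c)) ∈ S;
  cp_str1 : forall s, s ∈ S -> forall c d : csym LC,
    eqc c d ∈ s -> adj s (eqc d c) ∈ S;
  cp_str2 : forall s, s ∈ S ->
    forall (c d : csym LC) (phi : form LC) (v : nat),
    fv phi `<=` [set v] ->
    eqc c d ∈ s -> subst phi (inst1 v d) ∈ s ->
    adj s (subst phi (inst1 v c)) ∈ S;
  cp_str3 : forall s, s ∈ S -> forall d : csym LC,
    exists c : csym LC, sval c ∈ C /\ adj s (eqc c d) ∈ S
}.

End Consistency.

Section Generic.
Variables (V : groundModel) (P : set V) (le : V -> V -> Prop).

Record is_filter (F : set V) : Prop := {
  filter_sub : F `<=` P;
  filter_nonempty : F !=set0;
  filter_up : forall p q, F p -> P q -> le p q -> F q;
  filter_dir : forall p q, F p -> F q -> exists r, [/\ F r, le r p & le r q]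
}.

(* Dense subsets are elements of V, which makes genericity relative to V. *)
Definition dense_in (D : V) : Prop :=
  ext D `<=` P /\ forall p, P p -> exists q, q ∈ D /\ le q p.

Definition generic (F : set V) : Prop :=
  is_filter F /\ forall D : V, dense_in D -> ext D `&` F !=set0.

End Generic.

Definition PS (V : groundModel) (S : V) : set V :=
  [set p | exists s, s ∈ S /\ subs p s].

Definition lePS (V : groundModel) (p q : V) : Prop := subs q p.

Section TermStructure.
Variables (V : groundModel) (L : signature V) (C : V) (F : set V).
Local Notation LC := (addC L C).

Definition Sigma : set V := [set x | exists p, F p /\ x ∈ p].

(* Equivalence classes are predicates, as they need not belong to V. *)
Definition cls (e : csym LC) : set (csym LC) :=
  [set c | Sigma (eq_code (tcst e) (tcst c))].

Definition AF : structure LC := {|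
  dom := {X : set (csym LC) | range cls X};
  irel := fun R Xs => exists cs : seq (csym LC),
    map sval Xs = map cls cs /\ Sigma (rel_code R (map (@tcst V LC) cs));
  icst := fun d => exist _ (cls d) (ex_intro2 _ _ d I erefl)
|}.

End TermStructure.

(* Main.v *)
(** Every closure condition of a consistency property yields a dense set: if
    each element of S extending p can be enlarged by a member of A, then the
    conditions meeting A or incompatible with p are dense, so Sigma_F meets A
    as soon as p is in F.  Truth then follows by induction on the formula,
    simultaneously for it and its negation, over all closing substitutions of
    constants.

    Genericity only concerns dense sets that are elements of V, and the code of
    a substituted conjunction makes sense only when the set of substituted
    conjuncts is one.  Both require substitution, a recursion on formulae
    performed outside V, to be definable in V.  To that end a relation defined
    by a local recursion "R = op R" is obtained in V as the union of the sets t
    of V all of whose members are justified by op from t: well-foundedness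
    makes it functional, and replacement over a transitive closure makes it
    closed under op. *)
From Stdlib Require Import ClassicalEpsilon Relation_Operators Transitive_Closure.
Require Import Defs.
From mathcomp Require Import all_boot.
From mathcomp Require Import boolp classical_sets functions cardinality.

Set Implicit Arguments.
Unset Strict Implicit.
Unset Printing Implicit Defensive.

Local Open Scope classical_set_scope.

(** * Renaming of variables in formulae of set theory *)

Fixpoint stbound (f : stform) : nat :=
  match f with
  | STmem i j | STeq i j => maxn i.+1 j.+1
  | STneg g => stbound g
  | STand g h => maxn (stbound g) (stbound h)
  | STall i g => maxn i.+1 (stbound g)
  end.

(* Capture-avoiding renaming: [m] exceeds all the values of [r] in use. *)
Fixpoint stren (m : nat) (r : nat -> nat) (f : stform) : stform :=
  match f with
  | STmem i j => STmem (r i) (r j)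
  | STeq i j => STeq (r i) (r j)
  | STneg g => STneg (stren m r g)
  | STand g h => STand (stren m r g) (stren m r h)
  | STall i g => STall m (stren m.+1 (upd r i m) g)
  end.

(** De Bruijn convention: the new value takes index 0 and the old ones move up, so predicates on
    environments compose without any care for variable names. *)
Definition scons (T : Type) (x : T) (e : nat -> T) : nat -> T :=
  fun n => if n is k.+1 then e k else x.

Section Renaming.
Variables (T : Type) (E : T -> T -> Prop).

Lemma stsat_bound f (e e' : nat -> T) :
  (forall n, n < stbound f -> e n = e' n) -> stsat E e f <-> stsat E e' f.
Proof.
elim: f e e' => [i j|i j|g IH|g IHg h IHh|i g IH] e e' /= ee'.
- by rewrite !ee' // leq_max ltnSn ?orbT.
- by rewrite !ee' // leq_max ltnSn ?orbT.
- by rewrite (IH e e').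
- rewrite (IHg e e') ?(IHh e e') // => n ln; apply: ee'.
    by rewrite leq_max ln orbT.
  by rewrite leq_max ln.
- suff H x : stsat E (upd e i x) g <-> stsat E (upd e' i x) g.
    by split=> h x; apply/H.
  apply: IH => n ln; rewrite /upd; case: ifP => // _; apply: ee'.
  by rewrite leq_max ln orbT.
Qed.

Lemma stsat_ren f m r (e : nat -> T) :
  (forall n, n < stbound f -> r n < m) ->
  stsat E e (stren m r f) <-> stsat E (fun n => e (r n)) f.
Proof.
elim: f m r e => [i j|i j|g IH|g IHg h IHh|i g IH] m r e //= rm.
- by rewrite IH.
- rewrite IHg ?IHh // => n ln; apply: rm; first by rewrite leq_max ln orbT.
  by rewrite leq_max ln.
- suff H x : stsat E (upd e m x) (stren m.+1 (upd r i m) g) <->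
             stsat E (upd (fun n => e (r n)) i x) g.
    by split=> h x; apply/H.
  rewrite IH => [|n ln].
    apply: stsat_bound => n ln; rewrite /upd; case: (n == i); rewrite ?eqxx //.
    have /rm := leq_trans ln (leq_maxr i.+1 _).
    by rewrite ltn_neqAle => /andP[/negbTE -> _].
  rewrite /upd; case: (n == i) => //; apply: ltnW; rewrite ltnS; apply: rm.
  exact: leq_trans ln (leq_maxr _ _).
Qed.

End Renaming.

(** * Definable predicates and terms over the ground model *)

Section Definable.
Variable V : groundModel.
Implicit Types (P Q : (nat -> V) -> Prop) (a b c : (nat -> V) -> V).

(** Definability is a property of predicates of the metatheory, closed under the connectives below,
    so that no formula ever has to be written out. Parameters are entries of the environment. *)
Definition dfn P : Prop :=
  exists f : stform, forall e, P e <-> stsat (@gmem V) e f.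

(* Variable 0 stands for the value of the term. *)
Definition dterm a : Prop := dfn (fun e => e 0 = a (fun n => e n.+1)).

Lemma dfn_ext P Q : (forall e, P e <-> Q e) -> dfn P -> dfn Q.
Proof. by move=> PQ [f fP]; exists f => e; rewrite -PQ. Qed.

Lemma dfn_ren P r : dfn P -> dfn (fun e => P (fun n => e (r n))).
Proof.
move=> [f fP]; exists (stren (\max_(n < stbound f) (r n).+1) r f) => e.
rewrite stsat_ren // => n ln.
exact: (leq_bigmax (F := fun i : 'I_(stbound f) => (r i).+1) (Ordinal ln)).
Qed.

Lemma dfn_var_mem i j : dfn (fun e => e i ∈ e j).
Proof. by exists (STmem i j). Qed.

Lemma dfn_var_eq i j : dfn (fun e => e i = e j).
Proof. by exists (STeq i j). Qed.

Lemma dfn_not P : dfn P -> dfn (fun e => ~ P e).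
Proof. by move=> [f fP]; exists (STneg f) => e; rewrite fP. Qed.

Lemma dfn_and P Q : dfn P -> dfn Q -> dfn (fun e => P e /\ Q e).
Proof. by move=> [f fP] [g gQ]; exists (STand f g) => e; rewrite fP gQ. Qed.

Lemma dfn_or P Q : dfn P -> dfn Q -> dfn (fun e => P e \/ Q e).
Proof.
move=> dP dQ; apply: dfn_ext (dfn_not (dfn_and (dfn_not dP) (dfn_not dQ))) => e.
by case: (EM (P e)); case: (EM (Q e)); tauto.
Qed.

Lemma dfn_imp P Q : dfn P -> dfn Q -> dfn (fun e => P e -> Q e).
Proof.
move=> dP dQ; apply: dfn_ext (dfn_or (dfn_not dP) dQ) => e.
by case: (EM (P e)); tauto.
Qed.

Lemma dfn_iff P Q : dfn P -> dfn Q -> dfn (fun e => P e <-> Q e).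
Proof. by move=> dP dQ; apply: dfn_and; apply: dfn_imp. Qed.

Lemma dfn_all P : dfn P -> dfn (fun e => forall x, P (scons x e)).
Proof.
move=> [f fP].
have [m fm] : exists m, stbound f <= m by exists (stbound f).
(* [STall] binds a name without shifting the others: the index 0 is sent to [m], beyond the
   variables of [f], and every other index moves down by one. *)
pose r n := if n is k.+1 then k else m.
have [g gP] : dfn (fun e => stsat (@gmem V) (fun n => e (r n)) f).
  by apply: (dfn_ren (P := fun e => stsat _ e f)); exists f.
exists (STall m g) => e /=.
suff H x : P (scons x e) <-> stsat (@gmem V) (upd e m x) g.
  by split=> h x; apply/H.
rewrite -gP fP; apply: stsat_bound => -[|n] ln /=; rewrite /upd ?eqxx //.
by rewrite ltn_eqF // (leq_trans _ fm) // ltnW.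
Qed.

Lemma dfn_ex P : dfn P -> dfn (fun e => exists x, P (scons x e)).
Proof.
move=> dP; apply: dfn_ext (dfn_not (dfn_all (dfn_not dP))) => e.
by split=> [/existsNP[x /contrapT]|[x Px] h]; [exists x | exact: h Px].
Qed.

Lemma dterm_var i : dterm (fun e => e i).
Proof. exact: dfn_var_eq. Qed.

Lemma dterm_shift a : dterm a -> dterm (fun e => a (fun n => e n.+1)).
Proof.
by move=> da; apply: (dfn_ren (fun n => if n is k.+1 then k.+2 else 0) da).
Qed.

(** Only the graph of [a] is definable, so the substitution is expressed by an existential
    quantifier over the value of [a]. *)
Lemma dfn_subst P a : dfn P -> dterm a -> dfn (fun e => P (scons (a e) e)).
Proof.
move=> dP da; apply: dfn_ext (dfn_ex (dfn_and da dP)) => e.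
split=> [[x [xa Px]]|Pa]; last by exists (a e).
by have <- : x = a e := xa.
Qed.

Lemma dfn_comp1 (R : V -> Prop) :
  dfn (fun e => R (e 0)) -> forall a, dterm a -> dfn (fun e => R (a e)).
Proof. by move=> dR a; apply: (dfn_subst dR). Qed.

Lemma dfn_comp2 (R : V -> V -> Prop) : dfn (fun e => R (e 0) (e 1)) ->
  forall a b, dterm a -> dterm b -> dfn (fun e => R (a e) (b e)).
Proof.
move=> dR a b da db.
(* Arguments are plugged in one at a time: once [a] is in place, index 0 is the slot left for [b],
   and [a] reads the shifted environment. *)
have dR1 : dfn (fun e => R (a (fun n => e n.+1)) (e 0)).
  apply: (dfn_subst (P := fun e => R (e 0) (e 1)) _ (dterm_shift da)) => //.
exact: (dfn_subst dR1 db).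
Qed.

Lemma dfn_comp3 (R : V -> V -> V -> Prop) :
  dfn (fun e => R (e 0) (e 1) (e 2)) ->
  forall a b c, dterm a -> dterm b -> dterm c ->
    dfn (fun e => R (a e) (b e) (c e)).
Proof.
move=> dR a b c da db dc.
have dR1 : dfn (fun e => R (a (fun n => e n.+2)) (e 0) (e 1)).
  exact: (dfn_subst dR (dterm_shift (dterm_shift da))).
have dR2 : dfn (fun e => R (a (fun n => e n.+1)) (b (fun n => e n.+1)) (e 0)).
  exact: (dfn_subst dR1 (dterm_shift db)).
exact: (dfn_subst dR2 dc).
Qed.

Lemma dterm_comp2 (h : V -> V -> V) : dfn (fun e => e 0 = h (e 1) (e 2)) ->
  forall a b, dterm a -> dterm b -> dterm (fun e => h (a e) (b e)).
Proof.
move=> dh a b da db.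
exact: (dfn_comp3 (R := fun x y z => x = h y z) dh (dterm_var 0)
          (dterm_shift da) (dterm_shift db)).
Qed.

Lemma dfn_mem a b : dterm a -> dterm b -> dfn (fun e => a e ∈ b e).
Proof. by move=> da db; apply: dfn_comp2 => //; apply: dfn_var_mem. Qed.

Lemma dfn_eq a b : dterm a -> dterm b -> dfn (fun e => a e = b e).
Proof. by move=> da db; apply: dfn_comp2 => //; apply: dfn_var_eq. Qed.

End Definable.

Create HintDb dfn.

(** Under a quantifier the body, a function of [e] and [x], is presented as a predicate of a single
    environment with [x] at index 0. Only quantifiers over elements of the model are matched, the
    others not being first-order. *)
Ltac dfn_step :=
  cbv beta; match goal with
  | |- dfn (fun e => ~ _) => apply: dfn_not
  | |- dfn (fun e => _ /\ _) => apply: dfn_and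
  | |- dfn (fun e => _ \/ _) => apply: dfn_or
  | |- dfn (fun e => _ <-> _) => apply: dfn_iff
  | |- dfn (fun e => exists x : gsort _, @?Q e x) =>
      apply (@dfn_ex _ (fun e => Q (fun n => e n.+1) (e 0)))
  | |- dfn (fun e => forall x : gsort _, @?Q e x) =>
      apply (@dfn_all _ (fun e => Q (fun n => e n.+1) (e 0)))
  | |- dfn (fun e => _ -> _) => apply: dfn_imp
  | |- dfn (fun e => gmem _ _) => apply: dfn_mem
  | |- dfn (fun e => _ = _) => apply: dfn_eq
  | |- dterm (fun e => e ?i) => apply: dterm_var
  | |- _ => solve [auto with dfn nocore] || (progress auto with dfn nocore)
  end.
Ltac dfn_auto := repeat dfn_step.

(** * Elementary set theory inside the ground model *)

Section Sets.
Variable V : groundModel.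
Implicit Types (x y z w X Y : V) (P : (nat -> V) -> Prop).

Lemma ext_inj x y : (forall z, z ∈ x <-> z ∈ y) -> x = y.
Proof. exact: zfc_extensionality (gmem_zfc V) x y. Qed.

Lemma setofP (P : set V) :
  (exists z : V, forall w, w ∈ z <-> P w) -> forall w, w ∈ setof P <-> P w.
Proof. exact: epsilon_spec. Qed.

Lemma setof_ext x : setof (ext x) = x.
Proof. by apply: ext_inj; apply: setofP; exists x. Qed.

Lemma separation P (e : nat -> V) X : dfn P ->
  exists Y, forall x, x ∈ Y <-> x ∈ X /\ P (scons x e).
Proof.
move=> [f fP]; have [Y YP] :=
  zfc_separation (gmem_zfc V) f (fun n => if n is k.+1 then e k else X) X.
exists Y => x; rewrite YP fP.
suff -> : upd (fun n => if n is k.+1 then e k else X) 0 x = scons x e by [].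
by apply: funext => -[].
Qed.

(** The axiom requires exactly one value on each element. Here at most one is required: separation
    first restricts [X] to the domain [X'] of the relation. *)
Lemma replacement P (e : nat -> V) X : dfn P ->
  (forall x y z, x ∈ X -> P (scons x (scons y e)) -> P (scons x (scons z e)) ->
     y = z) ->
  exists Y, forall y, y ∈ Y <-> exists x, x ∈ X /\ P (scons x (scons y e)).
Proof.
move=> dP Pfun.
have dexP : dfn (fun e => exists y, P (scons (e 0) (scons y (fun n => e n.+1)))).
  apply: (dfn_ex (P := fun e => P (scons (e 1) (scons (e 0) (fun n => e n.+2))))).
  apply: dfn_ext (dfn_ren (fun n => match n with 0 => 1 | 1 => 0 | _ => n end) dP).
  move=> e'; set u := (X in P X <-> _); set v := (X in _ <-> P X).
  suff -> : u = v by [].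
  by apply: funext => -[|[]].
have [X' X'P] := separation e X dexP.
have [f fP] := dP.
(* Entries 0 and 1 are dummies that [upd] overwrites. *)
pose e' n := if n is k.+2 then e k else X.
have ue x y : upd (upd e' 0 x) 1 y = scons x (scons y e).
  by apply: funext => -[|[]].
have [x|Y YP] := zfc_replacement (gmem_zfc V) (f := f) (e := e') (a := X').
  move/X'P => [xX [y Py]]; exists y; split=> [|z]; rewrite ue -fP //.
  exact: Pfun.
exists Y => y; rewrite YP; split=> [[x [/X'P[xX _]]]|[x [xX Px]]].
  by rewrite ue -fP; exists x.
by exists x; rewrite ue -fP; split=> //; apply/X'P; split=> //; exists y.
Qed.

Definition env (s : seq V) : nat -> V := fun n => nth emp s n.

Lemma empP x : ~ x ∈ emp.
Proof.
have [X _] := zfc_infinity (gmem_zfc V).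
have [|Y YP] := @separation (fun e => ~ e 0 = e 0) (fun _ => X) X.
  by dfn_auto.
have emp0 : exists z : V, forall w, w ∈ z <-> set0 w.
  by exists Y => w; rewrite YP; split=> [[_ []]|[]].
by move/(setofP emp0).
Qed.

Lemma upairP x y z : z ∈ upair x y <-> z = x \/ z = y.
Proof.
exact: (setofP (P := [set w | w = x \/ w = y]) (zfc_pairing (gmem_zfc V) x y)).
Qed.

Definition unions x := setof [set z | exists y, y ∈ x /\ z ∈ y].

Lemma unionsP x z : z ∈ unions x <-> exists y, y ∈ x /\ z ∈ y.
Proof. exact: (setofP (zfc_union (gmem_zfc V) x)). Qed.

Lemma cupP x y z : z ∈ cup x y <-> z ∈ x \/ z ∈ y.
Proof.
apply: (setofP (P := ext x `|` ext y)).
exists (unions (upair x y)) => w; rewrite unionsP; split.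
  by move=> [u [/upairP[->|->]]]; [left|right].
by move=> [wx|wy]; [exists x|exists y]; rewrite upairP; auto.
Qed.

Lemma adjP x y z : z ∈ adj x y <-> z ∈ x \/ z = y.
Proof.
apply: (setofP (P := ext x `|` [set y])).
exists (cup x (upair y y)) => w; rewrite cupP upairP /=.
by split=> -[]; auto; case; auto.
Qed.

Definition power x := setof [set z : V | subs z x].

Lemma powerP x z : z ∈ power x <-> subs z x.
Proof. exact: (setofP (zfc_powerset (gmem_zfc V) x)). Qed.

Lemma opairP x y z : z ∈ opair x y <-> z = upair x x \/ z = upair x y.
Proof. exact: upairP. Qed.

Lemma upair_inj x y z : upair x y = upair x z -> y = z.
Proof.
move=> e; have /upairP[yx|//] : y ∈ upair x z by rewrite -e upairP; right.
have /upairP[|//] : z ∈ upair x y by rewrite e upairP; right.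
by rewrite yx.
Qed.

Lemma opair_inj x y x' y' : opair x y = opair x' y' -> x = x' /\ y = y'.
Proof.
move=> e; suff xx' : x = x'.
  subst x'; split=> //; have := e.
  exact: (fun h => upair_inj (upair_inj h)).
have /opairP[h|h] : upair x x ∈ opair x' y' by rewrite -e opairP; left.
  have /upairP[//|//] : x ∈ upair x' x' by rewrite -h upairP; left.
by have /upairP[<-|<-] : x' ∈ upair x x by rewrite h upairP; left.
Qed.

Lemma gmem_irr x : ~ x ∈ x.
Proof. by elim/(well_founded_ind (@gmem_wf V)): x => x IH xx; apply: (IH x). Qed.

Lemma num_lt m n : m < n -> (num m : V) ∈ num n.
Proof.
elim: n => // n IH; rewrite ltnS leq_eqVlt => /orP[/eqP ->|/IH h].
  by apply/adjP; right.
by apply/adjP; left.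
Qed.

Lemma num_inj : injective (@num V).
Proof.
move=> m n e; case: (ltngtP m n) => // /num_lt; rewrite e => h; case: (gmem_irr h).
Qed.

Lemma ktag_inj j k x y : ktag j x = ktag k y -> j = k /\ x = y.
Proof. by move=> /opair_inj[/num_inj -> ->]. Qed.

Lemma dterm_upair a b : dterm a -> dterm b -> dterm (fun e => @upair V (a e) (b e)).
Proof.
apply: dterm_comp2.
apply: (@dfn_ext _ (fun e => forall z, z ∈ e 0 <-> z = e 1 \/ z = e 2)).
  move=> e; split=> [h|-> z]; last exact: upairP.
  by apply: ext_inj => z; rewrite h upairP.
by dfn_auto.
Qed.

Lemma dterm_opair a b : dterm a -> dterm b -> dterm (fun e => @opair V (a e) (b e)).
Proof. by move=> da db; do 2?[apply: dterm_upair]. Qed.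

Lemma dterm_num n : dterm (fun _ => @num V n).
Proof.
elim: n => [|n IH] /=.
  apply: (@dfn_ext _ (fun e => forall z, ~ z ∈ e 0)); last by dfn_auto.
  move=> e; split=> [h|-> z]; last exact: empP.
  by apply: ext_inj => z; split=> [/h|/empP].
apply: (dterm_comp2 (h := @adj V)) => //.
apply: (@dfn_ext _ (fun e => forall z, z ∈ e 0 <-> z ∈ e 1 \/ z = e 2)).
  move=> e; split=> [h|-> z]; last exact: adjP.
  by apply: ext_inj => z; rewrite h adjP.
by dfn_auto.
Qed.

Lemma dterm_ktag k a : dterm a -> dterm (fun e => @ktag V k (a e)).
Proof. by move=> da; apply: dterm_opair => //; apply: dterm_num. Qed.

Lemma dfn_subs a b : dterm a -> dterm b -> dfn (fun e => @subs V (a e) (b e)).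
Proof.
apply: dfn_comp2.
by apply: (@dfn_ext _ (fun e => forall z, z ∈ e 0 -> z ∈ e 1)) => //; dfn_auto.
Qed.

End Sets.

#[export] Hint Resolve dterm_var dterm_upair dterm_opair dterm_num dterm_ktag dfn_subs : dfn.

(** * Transitive closures and cartesian products *)

Section TransitiveClosure.
Variable V : groundModel.
Implicit Types (x y z X Y T : V).

(** The components of a Kuratowski pair lie several memberships below it, hence recursion on codes
    descends along the transitive closure of membership. *)
Definition below : V -> V -> Prop := clos_trans V (@gmem V).

Lemma below_wf : well_founded below.
Proof. exact: wf_clos_trans (@gmem_wf V). Qed.

Lemma below_mem x y : x ∈ y -> below x y.
Proof. exact: t_step. Qed.

Lemma below_trans y x z : below x y -> below y z -> below x z.
Proof. exact: t_trans. Qed.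

Lemma below_opair2 x y : below y (opair x y).
Proof.
apply: (@below_trans (upair x y)); apply: below_mem; first by apply/upairP; right.
by apply/opairP; right.
Qed.

Definition transitive_set T := forall x, x ∈ T -> forall y, y ∈ x -> y ∈ T.

Lemma transitive_below T x y : transitive_set T -> x ∈ T -> below y x -> y ∈ T.
Proof.
move=> Ttr xT yx; elim: yx xT => {x y} [y x yx xT|y z x _ IH1 _ IH2 xT].
  exact: Ttr yx.
by apply/IH1/IH2.
Qed.

(** Minimality makes [T] unique, as replacement requires in the next proof. *)
Definition is_closure T x := [/\ transitive_set T, x ∈ T &
  forall T', transitive_set T' -> x ∈ T' -> subs T T'].

Lemma dfn_transitive a : dterm a -> dfn (fun e => transitive_set (a e)).
Proof.
apply: (@dfn_comp1 V transitive_set).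
by rewrite /transitive_set; dfn_auto.
Qed.
Hint Resolve dfn_transitive : dfn.

Lemma dfn_is_closure : dfn (fun e => is_closure (e 1) (e 0)).
Proof.
apply: (@dfn_ext _ (fun e => transitive_set (e 1) /\ e 0 ∈ e 1 /\
  forall T', transitive_set T' -> e 0 ∈ T' -> subs (e 1) T')).
  by move=> e; split=> [[? []]|[]].
by dfn_auto.
Qed.

(** By induction on membership: the closures of the elements of [x] form a set by replacement, and
    their union together with [x] is transitive. *)
Lemma transitive_closure x : exists T, is_closure T x.
Proof.
elim/(well_founded_ind (@gmem_wf V)): x => x IH.
have [|Y YP] := @replacement V (fun e => is_closure (e 1) (e 0)) (fun _ => x) x
  dfn_is_closure.
  move=> y T T' _ [/= tT yT mT] [/= tT' yT' mT'].
  by apply: ext_inj => z; split=> [/mT|/mT']; exact.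
pose U := adj (unions Y) x.
have Utr : transitive_set U.
  move=> y /adjP[/unionsP[T [TY yT]] z zy|-> z zx]; apply/adjP; left; apply/unionsP.
    exists T; split=> //; have /YP[a [_ [/= tT _ _]]] := TY; exact: tT zy.
  have [T Tz] := IH z zx; exists T; split; first by apply/YP; exists z.
  by case: Tz.
(* Minimality is enforced by keeping the elements of [U] common to all transitive sets that contain
   [x]. *)
have [|T TP] := @separation V
  (fun e => forall T', transitive_set T' -> e 1 ∈ T' -> e 0 ∈ T') (fun _ => x) U.
  by dfn_auto.
exists T; split=> /=.
- move=> y /TP[yU yT] z zy; apply/TP; split; first exact: Utr zy.
  by move=> /= T' tT' xT'; apply: tT' (yT _ tT' xT') _ zy.
- by apply/TP; split=> //; apply/adjP; right.
- by move=> T' tT' xT' z /TP[_]; apply.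
Qed.

Lemma product A B : exists P : V,
  forall z, z ∈ P <-> exists x y, [/\ x ∈ A, y ∈ B & z = opair x y].
Proof.
have [|P PP] := @separation V
  (fun e => exists x y, x ∈ e 1 /\ y ∈ e 2 /\ e 0 = opair x y)
  (env [:: A; B]) (power (power (cup A B))).
  by dfn_auto.
exists P => z; rewrite PP /=; split.
  by move=> [_ [x [y [? [? ?]]]]]; exists x, y.
move=> [x [y [xA yB ->]]]; split; last by exists x, y.
apply/powerP => u /opairP[] ->; apply/powerP => v /upairP[] ->; apply/cupP; auto.
Qed.

End TransitiveClosure.

(** * Definable recursion in the ground model *)

Section Recursion.
Variables (V : groundModel) (op : (V -> V -> V -> Prop) -> V -> V -> V -> Prop).
Implicit Types (x y z s t : V) (T : V -> V -> V -> Prop).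

Definition triple x s y : V := opair x (opair s y).

Hypothesis op_dfn : dfn (fun e => op (fun x s y => triple x s y ∈ e 3) (e 0) (e 1) (e 2)).
(** A recursive call may change the parameter [s], but only to a subset. All calls issued from [x]
    and [s] thus stay in the product of a transitive set containing [x] and the power set of [s]. *)
Hypothesis op_mono : forall T T' x s y, op T x s y ->
  (forall x' s' y', below x' x -> subs s' s -> T x' s' y' -> T' x' s' y') ->
  op T' x s y.
(** Two relations occur because the values compared may be justified by two different supported
    sets. *)
Hypothesis op_fun : forall T T' x s y y', op T x s y -> op T' x s y' ->
  (forall x' s' u v, below x' x -> T x' s' u -> T' x' s' v -> u = v) -> y = y'.

Definition supported t : Prop := forall x s y,
  triple x s y ∈ t -> op (fun x s y => triple x s y ∈ t) x s y.

(* The relation recursively defined by [Rec = op Rec]: a triple belongs to it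
   when some set of V contains it together with reasons for all its members. *)
Definition Rec x s y : Prop := exists t, supported t /\ triple x s y ∈ t.

Lemma triple_inj x s y x' s' y' :
  triple x s y = triple x' s' y' -> [/\ x = x', s = s' & y = y'].
Proof. by move=> /opair_inj[-> /opair_inj[-> ->]]. Qed.

Lemma dterm_triple a b c : dterm a -> dterm b -> dterm c ->
  dterm (fun e => triple (a e) (b e) (c e)).
Proof. by move=> da db dc; rewrite /triple; dfn_auto. Qed.

Lemma dfn_Rec a b c : dterm a -> dterm b -> dterm c ->
  dfn (fun e => Rec (a e) (b e) (c e)).
Proof.
apply: dfn_comp3; have tr := dterm_triple; rewrite /Rec.
have sup d : dterm d -> dfn (fun e => supported (d e)).
  apply: (@dfn_comp1 V supported); rewrite /supported; dfn_auto.
  (* The innermost quantifier of [supported] binds [y], so [y] has index 0 and [x] index 2, whereas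
     [op_dfn] has them the other way round. *)
  pose r n := match n with 0 => 2 | 1 => 1 | 2 => 0 | _ => n end.
  exact: (dfn_ren r op_dfn).
by dfn_auto.
Qed.

Lemma Rec_fun x s y y' : Rec x s y -> Rec x s y' -> y = y'.
Proof.
move=> [t [st xt]] [t' [st' xt']].
elim/(well_founded_ind (@below_wf V)): x s y y' xt xt' => x IH s y y' xt xt'.
by apply: (op_fun (st _ _ _ xt) (st' _ _ _ xt')) => x' s' u v /IH; apply.
Qed.

Lemma Rec_op x s y : Rec x s y -> op Rec x s y.
Proof.
by move=> [t [st xt]]; apply: (op_mono (st _ _ _ xt)) => x' s' y' _ _ ?; exists t.
Qed.

(** Uniqueness of values lets replacement collect in a set [t] all triples of [Rec] with arguments
    in the product of [T] and the power set of [s]. Adding the new triple to [t] gives a supported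
    set. *)
Lemma op_Rec x s y : op Rec x s y -> Rec x s y.
Proof.
move=> H; have [T [Ttr xT _]] := transitive_closure x.
have [D DP] := product T (power s).
have [||t tP] := @replacement V (fun e => exists x s y,
    e 0 = opair x s /\ e 1 = triple x s y /\ Rec x s y) (fun _ => x) D.
- by have tr := dterm_triple; have dR := dfn_Rec; dfn_auto.
- move=> w z z' _ [/= x1 [s1 [y1 [-> [-> R1]]]]] [x2 [s2 [y2 []]]].
  by move=> /opair_inj[<- <-] [-> /(Rec_fun R1) ->].
have inT x' s' y' : x' ∈ T -> subs s' s -> Rec x' s' y' -> triple x' s' y' ∈ t.
  move=> x'T s's R; apply/tP; exists (opair x' s'); split; last by exists x', s', y'.
  by apply/DP; exists x', s'; split=> //; apply/powerP.
exists (adj t (triple x s y)); split; last by apply/adjP; right.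
(* The calls issued from [x1] and [s1] remain in [T] and below [s], so their triples are already in
   [t] and [Rec] can be replaced by membership. *)
have mono x1 s1 y1 : x1 ∈ T -> subs s1 s -> op Rec x1 s1 y1 ->
    op (fun x0 s0 y0 => triple x0 s0 y0 ∈ adj t (triple x s y)) x1 s1 y1.
  move=> x1T s1s /op_mono; apply=> x' s' y' x'x1 s's1 R.
  apply/adjP; left; apply: inT => //; first exact: transitive_below x'x1.
  by move=> z /s's1 /s1s.
move=> x1 s1 y1 /adjP[/tP|/triple_inj[-> -> ->]]; last by apply: mono => // z.
move=> [_ [/DP [x2 [s2 [x2T /powerP s2s ->]]]]] /= [x3 [s3 [y3 []]]].
move=> /opair_inj[<- <-] [/triple_inj[-> -> ->]] R.
by apply: mono => //; apply: Rec_op.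
Qed.

End Recursion.

(** * Substitution as a definable relation between codes *)

Section CodeSubstitution.
Variable V : groundModel.
Implicit Types (x y z s u v a b W X Y : V) (T : V -> V -> V -> Prop).

(* In this section an assignment of constants to variables is an element [s]
   of V, a set of pairs (variable, constant). *)
Definition subst_val s n c := forall c', opair n c' ∈ s <-> c' = c.

Definition subst_term s u u' :=
  (exists c, u = ktag 1 c /\ u' = u) \/
  exists n, u = ktag 0 n /\
    ((exists c, subst_val s n c /\ u' = ktag 1 c) \/
     ~ (exists c, subst_val s n c) /\ u' = u).

Definition seq_step T a s b :=
  (a = emp /\ b = emp) \/
  exists u p v q, a = opair u p /\ b = opair v q /\ subst_term s u v /\ T p s q.

Definition subst_seq := Rec seq_step.

(** The counterpart of [mask] for assignments in V. It only removes pairs, which is what the subset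
    condition of the recursion allows for. *)
Definition masked W s s' :=
  forall z, z ∈ s' <-> z ∈ s /\ ~ exists n c, n ∈ W /\ z = opair n c.

(** The number [k] is the tag of the outermost symbol. Clauses 3 and 4 say that [b] is the image of
    [a], in a back-and-forth form that is monotone in [T]. *)
Definition form_clause (k : nat) T a s b : Prop :=
  match k with
  | 0 => exists R p q, a = opair R p /\ b = opair R q /\ subst_seq p s q
  | 1 => exists u v u' v', a = opair u v /\ b = opair u' v' /\
           subst_term s u u' /\ subst_term s v v'
  | 2 => T a s b
  | 3 | 4 => (forall x, x ∈ a -> exists y, y ∈ b /\ T x s y) /\
             (forall y, y ∈ b -> exists x, x ∈ a /\ T x s y)
  | 5 | 6 => exists W p q s', a = opair W p /\ b = opair W q /\
               masked W s s' /\ T p s' q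
  | _ => False
  end.

Definition form_step T x s y :=
  exists k a b, x = ktag k a /\ y = ktag k b /\ form_clause k T a s b.

Definition subst_form := Rec form_step.

Lemma subst_term_fun s u v v' : subst_term s u v -> subst_term s u v' -> v = v'.
Proof.
move=> [[c [-> ->]]|[n [-> un]]].
  by move=> [[c' [_ ->]]|[n' [/ktag_inj[]]]].
move=> [[c' [/ktag_inj[]]]|[n' [/ktag_inj[_ <-] un']]] //.
case: un un' => [[c [nc ->]]|[nc ->]] [[c' [nc' ->]]|[nc' ->]] //.
- by congr ktag; apply/nc'/nc.
- by case: nc'; exists c.
- by case: nc; exists c'.
Qed.

Lemma dfn_subst_val f g h : dterm f -> dterm g -> dterm h ->
  dfn (fun e => @subst_val (f e) (g e) (h e)).
Proof. by apply: dfn_comp3; rewrite /subst_val; dfn_auto. Qed.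
Hint Resolve dfn_subst_val : dfn.

Lemma dfn_subst_term f g h : dterm f -> dterm g -> dterm h ->
  dfn (fun e => @subst_term (f e) (g e) (h e)).
Proof. by apply: dfn_comp3; rewrite /subst_term; dfn_auto. Qed.
Hint Resolve dfn_subst_term : dfn.

Lemma dfn_masked f g h : dterm f -> dterm g -> dterm h ->
  dfn (fun e => @masked (f e) (g e) (h e)).
Proof. by apply: dfn_comp3; rewrite /masked; dfn_auto. Qed.
Hint Resolve dfn_masked : dfn.

Lemma emp_opair u v : emp = opair u v -> False.
Proof. by move=> e; apply: (@empP V (upair u u)); rewrite e opairP; left. Qed.

Lemma seq_step_dfn :
  dfn (fun e => seq_step (fun x s y => triple x s y ∈ e 3) (e 0) (e 1) (e 2)).
Proof.
by have tr := @dterm_triple V; have ne := @dterm_num V 0;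
  rewrite /seq_step; dfn_auto.
Qed.

Lemma seq_step_mono T T' x s y : seq_step T x s y ->
  (forall x' s' y', below x' x -> subs s' s -> T x' s' y' -> T' x' s' y') ->
  seq_step T' x s y.
Proof.
move=> [?|[u [p [v [q [-> [-> [? pq]]]]]]]] TT'; [by left|right].
exists u, p, v, q; do 3!split=> //.
by apply: TT' pq => //; apply: below_opair2.
Qed.

Lemma seq_step_fun T T' x s y y' : seq_step T x s y -> seq_step T' x s y' ->
  (forall x' s' u v, below x' x -> T x' s' u -> T' x' s' v -> u = v) -> y = y'.
Proof.
move=> [[-> ->]|[u [p [v [q [-> [-> [uv pq]]]]]]]].
  by move=> [[//]|[u [p [v [q [/emp_opair]]]]]].
move=> [[/esym/emp_opair//]|].
move=> [u' [p' [v' [q' [/opair_inj[<- <-] [-> [uv' pq']]]]]]] TT'.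
rewrite (subst_term_fun uv uv'); congr opair.
by apply: TT' pq pq'; apply: below_opair2.
Qed.

Lemma subst_seq_step a s b : seq_step subst_seq a s b -> subst_seq a s b.
Proof. exact: (op_Rec seq_step_dfn seq_step_mono seq_step_fun). Qed.

Lemma subst_seq_fun a s b b' : subst_seq a s b -> subst_seq a s b' -> b = b'.
Proof. exact: (Rec_fun seq_step_fun). Qed.

Lemma dfn_subst_seq f g h : dterm f -> dterm g -> dterm h ->
  dfn (fun e => @subst_seq (f e) (g e) (h e)).
Proof. exact: (dfn_Rec seq_step_dfn). Qed.
Hint Resolve dfn_subst_seq : dfn.

Lemma form_step_dfn :
  dfn (fun e => form_step (fun x s y => triple x s y ∈ e 3) (e 0) (e 1) (e 2)).
Proof.
(* The tag [k] ranges over [nat], so its quantifier is not first-order; it is replaced by a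
   disjunction over the seven tags. *)
pose st (k : nat) (e : nat -> V) := exists a b, e 0 = ktag k a /\ e 2 = ktag k b /\
  form_clause k (fun x s y => triple x s y ∈ e 3) a (e 1) b.
apply: (@dfn_ext _ (fun e => st 0 e \/ st 1 e \/ st 2 e \/ st 3 e \/ st 4 e \/
  st 5 e \/ st 6 e)).
  move=> e; split.
    have ex k : st k e -> form_step (fun x s y => triple x s y ∈ e 3) (e 0) (e 1) (e 2).
      by exists k.
    by move=> [|[|[|[|[|[|]]]]]]; exact: ex.
  move=> [k st_k]; move: st_k; rewrite -/(st k e).
  case: k => [|[|[|[|[|[|[|k]]]]]]]; rewrite ?orTb; try by tauto.
  by move=> [a [b [_ [_ []]]]].
have tr := @dterm_triple V; rewrite /st /form_clause.
by dfn_auto.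
Qed.

Lemma form_step_mono T T' x s y : form_step T x s y ->
  (forall x' s' y', below x' x -> subs s' s -> T x' s' y' -> T' x' s' y') ->
  form_step T' x s y.
Proof.
move=> [k [a [b [-> [-> cl]]]]] TT'; exists k, a, b; do 2!split=> //.
have ba z : z ∈ a -> below z (ktag k a).
  by move=> /below_mem xa; apply: below_trans xa (below_opair2 _ _).
have andor : form_clause 3 T a s b -> form_clause 3 T' a s b.
  move=> [H1 H2]; split=> z zin.
    by have [y' [y'b zy]] := H1 z zin; exists y'; split=> //; apply: TT' zy; auto.
  by have [y' [y'a zy]] := H2 z zin; exists y'; split=> //; apply: TT' zy; auto.
have quant : form_clause 5 T a s b -> form_clause 5 T' a s b.
  move=> [W [p [q [s' [ea [eb [m pq]]]]]]].
  exists W, p, q, s'; do 3!split=> //; apply: TT' pq; last by move=> z /m[].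
  rewrite ea; exact: below_trans (below_opair2 _ _) (below_opair2 _ _).
case: k cl TT' ba andor quant => [|[|[|[|[|[|[|]]]]]]] // cl TT' _ andor quant.
- by apply: TT' cl => //; apply: below_opair2.
- exact: andor.
- exact: andor.
- exact: quant.
- exact: quant.
Qed.

Lemma masked_fun W s s' s'' : masked W s s' -> masked W s s'' -> s' = s''.
Proof. by move=> m m'; apply: ext_inj => z; rewrite m m'. Qed.

Lemma form_step_fun T T' x s y y' : form_step T x s y -> form_step T' x s y' ->
  (forall x' s' u v, below x' x -> T x' s' u -> T' x' s' v -> u = v) -> y = y'.
Proof.
move=> [k [a [b [-> [-> cl]]]]] [_ [_ [b' [/ktag_inj[<- <-] [-> cl']]]]] TT'.
congr ktag.
have ba z : z ∈ a -> below z (ktag k a).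
  by move=> /below_mem xa; apply: below_trans xa (below_opair2 _ _).
have andor : form_clause 3 T a s b -> form_clause 3 T' a s b' -> b = b'.
  move=> [H1 H2] [H1' H2']; apply: ext_inj => z; split=> zb.
    have [u [xa xz]] := H2 _ zb; have [z' [z'b xz']] := H1' _ xa.
    by rewrite (TT' _ _ _ _ (ba _ xa) xz xz').
  have [u [xa xz]] := H2' _ zb; have [z' [z'b xz']] := H1 _ xa.
  by rewrite -(TT' _ _ _ _ (ba _ xa) xz' xz).
have quant : form_clause 5 T a s b -> form_clause 5 T' a s b' -> b = b'.
  move=> [W [p [q [s' [ea [-> [m pq]]]]]]].
  move=> [W' [p' [q' [s'' [ea' [-> [m' pq']]]]]]].
  have [eW ep] := opair_inj (etrans (esym ea) ea'); subst W' p'.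
  rewrite -(masked_fun m m') in pq'.
  congr opair; apply: TT' pq pq'; rewrite ea.
  exact: below_trans (below_opair2 _ _) (below_opair2 _ _).
case: k cl cl' TT' ba andor quant => [|[|[|[|[|[|[|]]]]]]] //.
- move=> [R [p [q [-> [-> pq]]]]] [_ [_ [q' [/opair_inj[<- <-] [-> pq']]]]] _ _ _ _.
  by rewrite (subst_seq_fun pq pq').
- move=> [u [v [u' [v' [-> [-> [uu vv]]]]]]].
  move=> [_ [_ [u2 [v2 [/opair_inj[<- <-] [-> [uu2 vv2]]]]]]] _ _ _ _.
  by rewrite (subst_term_fun uu uu2) (subst_term_fun vv vv2).
- by move=> cl cl' TT' _ _ _; apply: TT' cl cl'; apply: below_opair2.
- by move=> cl cl' _ _ h _; exact: h.
- by move=> cl cl' _ _ h _; exact: h.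
- by move=> cl cl' _ _ _ h; exact: h.
- by move=> cl cl' _ _ _ h; exact: h.
Qed.

Lemma subst_form_step x s y : form_step subst_form x s y -> subst_form x s y.
Proof. exact: (op_Rec form_step_dfn form_step_mono form_step_fun). Qed.

Lemma subst_form_fun x s y y' : subst_form x s y -> subst_form x s y' -> y = y'.
Proof. exact: (Rec_fun form_step_fun). Qed.

Lemma dfn_subst_form f g h : dterm f -> dterm g -> dterm h ->
  dfn (fun e => @subst_form (f e) (g e) (h e)).
Proof. exact: (dfn_Rec form_step_dfn). Qed.

End CodeSubstitution.
#[export] Hint Resolve dfn_subst_form : dfn.

(** * Agreement of substitution on parse trees with substitution on codes *)

Section Substitution.
Variables (V : groundModel) (L : signature V).
Implicit Types (x y z : V) (s : nat -> option (csym L)).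

Definition represents s (sg : V) := forall z, z ∈ sg <->
  exists n c, s n = Some c /\ z = opair (num n) (sval c).

Lemma representsP s sg n c : represents s sg ->
  opair (num n) c ∈ sg <-> exists h : c ∈ csts L, s n = Some (exist _ c h).
Proof.
move=> ->; split; last by move=> [h sn]; exists n, (exist _ c h).
by move=> [m [[d dh] [sm /opair_inj[/num_inj -> ->]]]]; exists dh.
Qed.

Definition finite_support s := exists N, forall n, N <= n -> s n = None.

(** Finite support is what guarantees a graph inside V: it is built by adjoining one pair at a time,
    while an arbitrary map of the metatheory might not belong to V. *)
Lemma represents_exists s : finite_support s -> exists sg, represents s sg.
Proof.
move=> [N sN].
have [sg sgP] : exists sg : V, forall z, z ∈ sg <->
    exists n c, [/\ n < N, s n = Some c & z = opair (num n) (sval c)].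
  elim: N {sN} => [|N [sg IH]].
    by exists emp => z; split=> [/empP|[n [c []]]].
  case sN: (s N) => [c|]; last first.
    exists sg => z; rewrite IH; split=> -[n [d [nN sn ->]]]; exists n, d; split=> //.
      exact: ltnW.
    by move: nN; rewrite ltnS leq_eqVlt => /orP[/eqP nN|//]; rewrite -nN sn in sN.
  exists (adj sg (opair (num N) (sval c))) => z; rewrite adjP IH; split.
    move=> [[n [d [nN sn ->]]]|->]; last by exists N, c.
    by exists n, d; split=> //; apply: ltnW.
  move=> [n [d [nN sn ->]]]; move: nN; rewrite ltnS leq_eqVlt => /orP[/eqP nN|nN].
    by right; move: sn; rewrite nN sN => -[->].
  by left; exists n, d.
exists sg => z; rewrite sgP; split=> [[n [c [_ sn ->]]]|[n [c [sn ->]]]]; exists n, c.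
  by [].
by split=> //; rewrite ltnNge; apply/negP => /sN; rewrite sn.
Qed.

Lemma mask_support W s : finite_support s -> finite_support (Defs.mask W s).
Proof.
by move=> [N sN]; exists N => n /sN sn; rewrite /Defs.mask sn; case: ifP.
Qed.

Lemma represents_mask W s sg : represents s sg ->
  exists sg', masked W sg sg' /\ represents (Defs.mask W s) sg'.
Proof.
move=> ssg.
have [|sg' sg'P] := @separation V
  (fun e => ~ exists n c, n ∈ e 1 /\ e 0 = opair n c) (fun _ => W) sg.
  by dfn_auto.
exists sg'; split=> // z; rewrite sg'P /= ssg /Defs.mask; split.
  move=> [[n [c [sn ->]]] nW]; exists n, c; split=> //; case: ifP => // /asboolP h.
  by case: nW; exists (num n), (sval c).
move=> [n [c []]]; case: ifPn => // /asboolP nW sn ->; split; first by exists n, c.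
by move=> [m [d [mW /opair_inj[nm _]]]]; rewrite nm in nW.
Qed.

Lemma subst_term_tsubst s sg (t : term L) : represents s sg ->
  subst_term sg (tcode t) (tcode (tsubst s t)).
Proof.
move=> ssg; case: t => [n|c] /=; last by left; exists (sval c).
right; exists (num n); split=> //.
case sn: (s n) => [c|].
  left; exists (sval c); split=> // c'; rewrite (representsP _ _ ssg) sn; split=> [[h [->]]//|->].
  by case: c {sn} => c h; exists h.
by right; split=> // -[c /(_ c) [_ /(_ erefl) /(representsP _ _ ssg)]]; rewrite sn => -[].
Qed.

Lemma subst_seq_tsubst s sg (ts : seq (term L)) : represents s sg ->
  subst_seq (seqcode ts) sg (seqcode (map (tsubst s) ts)).
Proof.
move=> ssg; elim: ts => [|t ts IH]; apply: subst_seq_step; first by left.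
right; exists (tcode t), (seqcode ts), (tcode (tsubst s t)), (seqcode (map (tsubst s) ts)).
by do 3!split=> //; apply: subst_term_tsubst.
Qed.

(** [setof] has the intended elements only when some element of V does. Replacement provides it, as
    the external map [g] agrees with the definable [subst_form]. *)
Lemma subst_form_image X (g : forall x, x ∈ X -> V) sg :
  (forall x h, subst_form x sg (g x h)) ->
  forall y, y ∈ setof [set y | exists x h, y = g x h] <-> exists x h, y = g x h.
Proof.
move=> gsub; apply: (setofP (P := [set y | exists x h, y = g x h])).
have [||Y YP] := @replacement V (fun e => subst_form (e 0) (e 2) (e 1))
  (fun _ => sg) X.
- by dfn_auto.
- by move=> x y z _; apply: subst_form_fun.
exists Y => y; rewrite YP; split=> /= [[x [xX /subst_form_fun e]]|[x [xX ->]]].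
  by exists x, xX; apply: e.
by exists x.
Qed.

Lemma subst_form_presubst x (d : preform L x) s sg : represents s sg ->
  subst_form x sg (presubst d s).
Proof.
have andor k X (f : forall x, x ∈ X -> preform L x) s' sg' : k = 3 \/ k = 4 ->
    (forall x h, subst_form x sg' (presubst (f x h) s')) ->
    subst_form (ktag k X) sg'
      (ktag k (setof [set y | exists x h, y = presubst (f x h) s'])).
  move=> k34 IH; apply: subst_form_step; exists k; do 2!eexists; do 2!split=> //.
  have := subst_form_image IH; set Y := setof _ => YP.
  suff : form_clause 3 (@subst_form V) X sg' Y by case: k34 => ->.
  split=> [z zX|y /YP[z [zX ->]]]; last by exists z.
  by exists (presubst (f z zX) s'); split=> //; apply/YP; exists z, zX.
have quant k W z (g : (nat -> option (csym L)) -> V) s' sg' : k = 5 \/ k = 6 ->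
    (forall s sg, represents s sg -> subst_form z sg (g s)) ->
    represents s' sg' ->
    subst_form (ktag k (opair W z)) sg' (ktag k (opair W (g (Defs.mask W s')))).
  move=> k56 IH ssg; have [sg2 [m sg2P]] := represents_mask W ssg.
  apply: subst_form_step; exists k; do 2!eexists; do 2!split=> //.
  suff : form_clause 5 (@subst_form V) (opair W z) sg' (opair W (g (Defs.mask W s'))).
    by case: k56 => ->.
  by exists W, z, (g (Defs.mask W s')), sg2; do 3!split=> //; apply: IH.
elim: d s sg => {x} [R ts Rr Ra|t u|x d IH|X f IH|X f IH|W x Wv d IH|W x Wv d IH]
  s sg ssg /=.
- apply: subst_form_step; exists 0; do 2!eexists; do 2!split=> //.
  by do 3!eexists; do 2!split=> //; apply: subst_seq_tsubst.
- apply: subst_form_step; exists 1; do 2!eexists; do 2!split=> //.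
  by do 4!eexists; do 3!split=> //; apply: subst_term_tsubst.
- apply: subst_form_step; exists 2; do 2!eexists; do 2!split=> //.
  exact: IH.
- by apply: andor; [left|move=> x h; apply: IH].
- by apply: andor; [right|move=> x h; apply: IH].
- by apply: (quant 5 W x (presubst d)) => //; left.
- by apply: (quant 6 W x (presubst d)) => //; right.
Qed.

(** Both results are related by [subst_form] to the same code, and that relation is functional and
    does not mention trees. *)
Lemma presubst_unique x (d d' : preform L x) s : finite_support s ->
  presubst d s = presubst d' s.
Proof.
move=> /represents_exists[sg ssg].
exact: subst_form_fun (subst_form_presubst d ssg) (subst_form_presubst d' ssg).
Qed.

Lemma presubst_imageP X (f : forall x, x ∈ X -> preform L x) s :
  finite_support s -> forall y,
  y ∈ setof [set y | exists x h, y = presubst (f x h) s] <->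
    exists x h, y = presubst (f x h) s.
Proof.
move=> /represents_exists[sg ssg]; apply: (@subst_form_image _ _ sg) => x h.
exact: subst_form_presubst.
Qed.

Lemma presubst_none x (d : preform L x) : presubst d (fun _ => None) = x.
Proof.
have tnone (t : term L) : tsubst (fun _ => None) t = t by case: t.
have mnone W : Defs.mask W (fun _ => None) = (fun _ => None) :> (nat -> option (csym L)).
  by apply: funext => n; rewrite /Defs.mask; case: ifP.
have img X (f : forall x, x ∈ X -> preform L x) :
    (forall x h, presubst (f x h) (fun _ => None) = x) ->
    setof [set y | exists x h, y = presubst (f x h) (fun _ => None)] = X.
  move=> fx; rewrite -[RHS]setof_ext; congr setof; apply/seteqP; split=> y /=.
    by move=> [z [zX ->]]; rewrite fx.
  by move=> yX; exists y, yX; rewrite fx.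
elim: d => {x} /= [R ts Rr Ra|t u|x d IH|X f IH|X f IH|W x Wv d IH|W x Wv d IH].
- by rewrite (eq_map tnone) map_id.
- by rewrite !tnone.
- by rewrite IH.
- by rewrite img.
- by rewrite img.
- by rewrite mnone IH.
- by rewrite mnone IH.
Qed.

(** Composition of substitutions: the values are constants, so [s'] acts only on the variables that
    [s] leaves alone. *)
Definition scomp s s' : nat -> option (csym L) :=
  fun n => if s n is Some c then Some c else s' n.

Lemma scomp_support s s' :
  finite_support s -> finite_support s' -> finite_support (scomp s s').
Proof.
move=> [N sN] [N' sN']; exists (maxn N N') => n; rewrite geq_max => /andP[h h'].
by rewrite /scomp sN // sN'.
Qed.

Lemma mask_scomp W s s' :
  scomp (Defs.mask W s) (Defs.mask W s') = Defs.mask W (scomp s s').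
Proof. by apply: funext => n; rewrite /scomp /Defs.mask; case: ifP. Qed.

Lemma tsubst_scomp s s' t : tsubst s' (tsubst s t) = tsubst (scomp s s') t.
Proof. by case: t => [n|c] //=; rewrite /scomp; case: (s n). Qed.

Lemma tsubst_var s t n : tsubst s t = tvar L n -> t = tvar L n.
Proof. by case: t => //= m; case: (s m). Qed.

(** The consistency property speaks of elements of [form], so a substituted formula needs a parse
    tree of its own. The last clause computes further substitutions on the original tree. *)
Lemma presubst_tree x (d : preform L x) s : finite_support s -> finfree d ->
  exists d' : preform L (presubst d s),
    [/\ finfree d', free d' `<=` free d &
        forall s', finite_support s' -> presubst d' s' = presubst d (scomp s s')].
Proof.
have andor X (f : forall x, x ∈ X -> preform L x) s0 : finite_support s0 ->
    (forall x h, exists d' : preform L (presubst (f x h) s0),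
      [/\ finfree d', free d' `<=` free (f x h) & forall s', finite_support s' ->
          presubst d' s' = presubst (f x h) (scomp s0 s')]) ->
    exists f' : (forall y,
        y ∈ setof [set y | exists x h, y = presubst (f x h) s0] -> preform L y),
      [/\ forall y h, finfree (f' y h),
          [set n | exists y h, free (f' y h) n] `<=`
            [set n | exists x h, free (f x h) n] &
          forall s', finite_support s' ->
            [set z | exists y h, z = presubst (f' y h) s'] =
            [set z | exists x h, z = presubst (f x h) (scomp s0 s')]].
  move=> s0fin IH; have := presubst_imageP f s0fin; set Y := setof _ => YP.
  have tree y (h : y ∈ Y) : exists d : preform L y, finfree d /\
      (exists x hx, [/\ y = presubst (f x hx) s0, free d `<=` free (f x hx) &
        forall s', finite_support s' ->
          presubst d s' = presubst (f x hx) (scomp s0 s')]).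
    move: (h) => /YP [w [hw yE]]; subst y.
    by have [d' [? ? ?]] := IH w hw; exists d'; split=> //; exists w, hw.
  (* Several members of [X] may become the same [y], so a tree over [y] is chosen. *)
  pose f' y h := projT1 (cid (tree y h)).
  have f'P y h := projT2 (cid (tree y h)).
  exists f'; split=> [y h|n [y [h]]|s' s'fin].
  - by have [] := f'P y h.
  - by have [_ [w [hw [_ sub _]]]] := f'P y h; exists w, hw; apply: sub.
  apply/seteqP; split=> z [y [h ->]].
    by have [_ [w [hw [_ _ e]]]] := f'P y h; exists w, hw; rewrite -e.
  (* The tree chosen for this code may come from another member of [X]; [presubst_unique] makes the
     choice harmless. *)
  have h' : presubst (f y h) s0 ∈ Y by apply/YP; exists y, h.
  have [d' [_ _ e]] := IH y h.
  by exists (presubst (f y h) s0), h'; rewrite -e //; apply: presubst_unique.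
elim: d s => {x} [R ts Rr Ra|t u|x d IH|X f IH|X f IH|W x Wv d IH|W x Wv d IH]
  s sfin /=.
- move=> _; have Ra' : opair R (num (size (map (tsubst s) ts))) ∈ arity L.
    by rewrite size_map.
  exists (Prel Rr Ra'); split=> // [n /=|s' _ /=].
    elim: ts {Ra Ra'} => //= t ts IH [tn|/IH]; [left|by right].
    exact: tsubst_var tn.
  by rewrite -map_comp (eq_map (fun t => tsubst_scomp s s' t)).
- move=> _; exists (Defs.Peq (tsubst s t) (tsubst s u)); split=> // [n /=|s' _ /=].
    by move=> [/tsubst_var|/tsubst_var]; auto.
  by rewrite !tsubst_scomp.
- move=> /(IH _ sfin)[d' [? ? e]]; exists (Pneg d'); split=> // s' s'fin /=.
  by rewrite e.
- move=> [Xfin ff]; have [x h|f' [ff' sub e]] := andor X f s sfin.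
    by apply: IH => //.
  exists (Pand f'); split=> [||s' s'fin] //=; last by rewrite e.
  by split=> //; apply: sub_finite_set sub Xfin.
- move=> [Xfin ff]; have [x h|f' [ff' sub e]] := andor X f s sfin.
    by apply: IH => //.
  exists (Por f'); split=> [||s' s'fin] //=; last by rewrite e.
  by split=> //; apply: sub_finite_set sub Xfin.
- move=> /(IH _ (mask_support W sfin))[d' [? sub e]]; exists (Pall Wv d'); split=> //=.
    by move=> n [/sub].
  by move=> s' s'fin; rewrite e ?mask_scomp //; apply: mask_support.
- move=> /(IH _ (mask_support W sfin))[d' [? sub e]]; exists (Pex Wv d'); split=> //=.
    by move=> n [/sub].
  by move=> s' s'fin; rewrite e ?mask_scomp //; apply: mask_support.
Qed.

End Substitution.

Lemma singletonP (V : groundModel) (x y : V) : x ∈ upair y y <-> x = y.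
Proof. by rewrite upairP; tauto. Qed.

(** * Density arguments and the closure properties of [Sigma] *)

Section Generic.
Variables (V : groundModel) (L : signature V) (C S : V) (F : set V).
Local Notation LC := (addC L C).
Local Notation eqc c d := (eq_code (tcst c) (tcst d)).
Hypothesis S_cp : consistency_property L C S.
Hypothesis F_generic : generic (PS S) (@lePS V) F.
Implicit Types (x y z p s A : V) (c d : csym LC).

Lemma generic_meets p A : F p ->
  (forall s, s ∈ S -> subs p s -> exists x, x ∈ A /\ adj s x ∈ S) ->
  exists x, x ∈ A /\ Sigma F x.
Proof.
have [[FP Fne Fup Fdir] Fgen] := F_generic => Fp step.
(* Every condition is a subset of the union of [S], so its power set bounds [D]. The second
   alternative is incompatibility with [p]. *)
have [|D DP] := @separation V (fun e => (exists s, s ∈ e 1 /\ subs (e 0) s) /\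
    ((exists x, x ∈ e 2 /\ x ∈ e 0) \/
     ~ exists s, s ∈ e 1 /\ subs (e 0) s /\ subs (e 3) s))
  (env [:: S; A; p]) (power (unions S)).
  by dfn_auto.
have inD q s : s ∈ S -> subs q s -> (exists x, x ∈ A /\ x ∈ q) \/
    ~ (exists s, s ∈ S /\ subs q s /\ subs p s) -> q ∈ D.
  move=> sS qs h; apply/DP; split; last by split=> //; exists s.
  by apply/powerP => z /qs zs; apply/unionsP; exists s.
have [|q [/DP[_ [_ q_or]] Fq]] := Fgen D.
  split=> [q /DP[_ [[s [sS qs]] _]]|q [s [sS qs]]]; first by exists s.
  (* If [q] is compatible with [p], a common extension in [S] is enlarged by a member of [A];
     otherwise [q] itself is in [D]. *)
  case: (EM (exists s, s ∈ S /\ subs q s /\ subs p s)) => [[r [rS [qr pr]]]|no].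
    have [x [xA rxS]] := step r rS pr; exists (adj r x); split.
      apply: (inD _ _ rxS) => //; left; exists x; split=> //.
      by apply/adjP; right.
    by move=> z /qr zr; apply/adjP; left.
  by exists q; split=> //; apply: (inD _ _ sS) => //; right.
(* Since [p] and [q] both lie in the filter, a common extension excludes the incompatible
   alternative. *)
case: q_or => /= [[x [xA xq]]|[]]; first by exists x; split=> //; exists q.
have [r [Fr rp rq]] := Fdir _ _ Fp Fq; have [s [sS rs]] := FP _ Fr.
by exists s; split=> //; split=> z; [move=> /rq/rs|move=> /rp/rs].
Qed.

Lemma Sigma_common x y : Sigma F x -> Sigma F y ->
  exists p, [/\ F p, x ∈ p & y ∈ p].
Proof.
have [[_ _ _ Fdir] _] := F_generic => -[p [Fp xp]] [q [Fq yq]].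
have [r [Fr rp rq]] := Fdir _ _ Fp Fq.
by exists r; split=> //; [apply: rp|apply: rq].
Qed.

Lemma Sigma_in_S x y : Sigma F x -> Sigma F y ->
  exists s, [/\ s ∈ S, x ∈ s & y ∈ s].
Proof.
have [[FP _ _ _] _] := F_generic => Sx Sy.
have [p [/FP[s [sS ps]] xp yp]] := Sigma_common Sx Sy.
by exists s; split=> //; apply: ps.
Qed.

Lemma Sigma_meets x A : Sigma F x ->
  (forall s, s ∈ S -> x ∈ s -> exists y, y ∈ A /\ adj s y ∈ S) ->
  exists y, y ∈ A /\ Sigma F y.
Proof.
by move=> [p [Fp xp]] step; apply: (generic_meets Fp) => s sS /(_ _ xp); apply: step.
Qed.

(** Directedness puts both premises in one condition, to which the density argument applies with the
    singleton of [z] as set of witnesses. *)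
Lemma Sigma_rule2 x y z : Sigma F x -> Sigma F y ->
  (forall s, s ∈ S -> x ∈ s -> y ∈ s -> adj s z ∈ S) -> Sigma F z.
Proof.
move=> Sx Sy step; have [p [Fp xp yp]] := Sigma_common Sx Sy.
have [s sS ps|w [/singletonP <-]] // := generic_meets (A := upair z z) Fp.
by exists z; split; [apply/singletonP|apply: step => //; apply: ps].
Qed.

Lemma Sigma_rule x z : Sigma F x ->
  (forall s, s ∈ S -> x ∈ s -> adj s z ∈ S) -> Sigma F z.
Proof. by move=> Sx step; apply: (Sigma_rule2 Sx Sx) => s sS xs _; apply: step. Qed.

Lemma Sigma_con (phi : form LC) : Sigma F phi -> ~ Sigma F (neg_code phi).
Proof.
move=> Sp Sn; have [s [sS ps ns]] := Sigma_in_S Sp Sn.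
exact: (cp_con S_cp sS (conj ps ns)).
Qed.

Lemma Sigma_neg_in (phi : form LC) : Sigma F (neg_code phi) -> Sigma F (neg_in phi).
Proof. by move=> Sn; apply: (Sigma_rule Sn) => s sS /(cp_ind1 S_cp sS). Qed.

Lemma Sigma_and X x : Sigma F (and_code X) -> x ∈ X -> Sigma F x.
Proof. by move=> SX xX; apply: (Sigma_rule SX) => s sS /(cp_ind2 S_cp sS); apply. Qed.

Lemma Sigma_or X : Sigma F (or_code X) -> exists x, x ∈ X /\ Sigma F x.
Proof. by move=> SX; apply: (Sigma_meets SX) => s sS /(cp_ind4 S_cp sS). Qed.

Lemma Sigma_all W (phi : form LC) (c : nat -> csym LC) :
  Sigma F (all_code W phi) -> Sigma F (subst phi (inst W c)).
Proof. by move=> SW; apply: (Sigma_rule SW) => s sS /(cp_ind3 S_cp sS); apply. Qed.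

Lemma inst_support W (c : nat -> csym LC) : varset W -> finite_support (inst W c).
Proof.
move=> [vs Wvs]; exists (\max_(n <- vs) n.+1) => n; rewrite /inst.
case: ifPn => // /asboolP/Wvs[m [mvs /num_inj nm]]; subst m.
by rewrite leqNgt => /negP[]; apply: (@leq_bigmax_seq _ _ xpredT succn).
Qed.

(* The set [A] of possible witnesses is an element of V since substitution is
   definable in V; it must be, for the corresponding dense set to be in V. *)
Lemma Sigma_ex W (phi : form LC) : varset W -> Sigma F (ex_code W phi) ->
  exists c : nat -> csym LC, Sigma F (subst phi (inst W c)).
Proof.
move=> Wvs SW.
(* [c0] only supplies a default constant for variables outside [W], which [inst] ignores. *)
have [s0 [s0S Ws0 _]] := Sigma_in_S SW SW.
have [c0 _] := cp_ind5 S_cp s0S Ws0.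
have [|A AP] := @separation V (fun e => exists sg : V,
    (forall n : V, n ∈ e 1 -> exists c : V, c ∈ e 2 /\ subst_val sg n c) /\
    (forall z : V, z ∈ sg -> exists n c : V, n ∈ e 1 /\ z = opair n c) /\
    subst_form (e 3) sg (e 0)) (env [:: W; C; fcode phi]) (unions S).
  by have dv := @dfn_subst_val V; dfn_auto.
have [s sS Ws|y [/AP[_ /= [sg [sgW [Wsg phi_y]]]] Sy]] := Sigma_meets (A := A) SW.
  have [c [cC cS]] := cp_ind5 S_cp sS Ws.
  exists (subst phi (inst W c)); split=> //; apply/AP; split.
    by apply/unionsP; eexists; split; [exact: cS|apply/adjP; right].
  have [sg ssg] := represents_exists (inst_support c Wvs).
  exists sg => /=; split; last first.
    split; last exact: subst_form_presubst.
    move=> z /ssg[n [d [+ ->]]]; rewrite /inst; case: ifPn => // /asboolP nW _.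
    by exists (num n), (sval d).
  move=> n nW; have [vs vsP] := Wvs; have /vsP[m [_ nm]] := nW; subst n.
  exists (sval (c m)); split; first exact: cC.
  move=> c'; rewrite (representsP _ _ ssg) /inst.
  case: ifPn => /asboolP // _; split=> [[h [->]]//|->].
  by case: (c m) => d h; exists h.
(* The assignment [sg] found in V is turned back into a function on indices, one constant being
   chosen for each. *)
have cP n : exists c : csym LC, num n ∈ W -> subst_val sg (num n) (sval c).
  case: (EM (num n ∈ W)) => [/sgW[c [cC sc]]|nW]; last by exists (c0 0).
  have cLC : c ∈ csts LC by apply/cupP; right.
  by exists (exist _ c cLC).
have {cP} [c cP] := choice cP.
exists c; suff ssg : represents (inst W c) sg.
  by rewrite /subst (subst_form_fun (subst_form_presubst (ftree phi) ssg) phi_y).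
have [vs vsP] := Wvs.
move=> z; split.
  move=> zsg; have [n [d [nW zE]]] := Wsg _ zsg.
  have /vsP[m [_ nm]] := nW; subst n z; exists m, (c m).
  rewrite /inst; case: ifPn => /asboolP // _; split=> //.
  by have /(cP _ nW) <- := zsg.
move=> [n [d []]]; rewrite /inst; case: ifPn => // /asboolP nW [<-] ->.
exact/(cP _ nW).
Qed.

Lemma Sigma_replace c d (phi : form LC) v : fv phi `<=` [set v] ->
  Sigma F (eqc c d) -> Sigma F (subst phi (inst1 v d)) ->
  Sigma F (subst phi (inst1 v c)).
Proof.
by move=> fvphi Scd Sd; apply: (Sigma_rule2 Scd Sd) => s sS; apply: cp_str2.
Qed.

Lemma Sigma_sym c d : Sigma F (eqc c d) -> Sigma F (eqc d c).
Proof. by move=> Scd; apply: (Sigma_rule Scd) => s sS; apply: cp_str1. Qed.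

Lemma Sigma_trans c d e :
  Sigma F (eqc c d) -> Sigma F (eqc d e) -> Sigma F (eqc c e).
Proof.
move=> Scd Sde.
(* With variable 0 as left-hand side, (Str.2) turns [d = e] into [c = e]. *)
pose phi := @Form V LC _ (Defs.Peq (tvar LC 0) (tcst e)) I.
apply: (@Sigma_replace c d phi 0 _ Scd) => //.
by move=> n [[<-]|].
Qed.

Lemma Sigma_str3 d : exists c, sval c ∈ C /\ Sigma F (eqc c d).
Proof.
have [[_ [p Fp] _ _] _] := F_generic.
(* The equations between a member of [C] and [d], with [eq_code] unfolded into tags and pairs so
   that definability can be read off. *)
have [|A AP] := @separation V (fun e => exists c : V, c ∈ e 1 /\
    e 0 = ktag 1 (opair (ktag 1 c) (ktag 1 (e 2)))) (env [:: C; sval d]) (unions S).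
  by dfn_auto.
have [s sS ps|x [/AP[_ /= [c [cC ->]]] Sx]] := generic_meets (A := A) Fp.
  have [c [cC cS]] := cp_str3 S_cp sS d.
  exists (eqc c d); split=> //; apply/AP; split; last by exists (sval c).
  by apply/unionsP; eexists; split; [exact: cS|apply/adjP; right].
have cLC : c ∈ csts LC by apply/cupP; right.
by exists (exist _ c cLC).
Qed.

(** Reflexivity is not among the closure conditions: (Str.3) provides some [c = d], and symmetry
    followed by transitivity gives [d = d]. *)
Lemma Sigma_refl d : Sigma F (eqc d d).
Proof.
have [c [_ Scd]] := Sigma_str3 d.
exact: Sigma_trans (Sigma_sym Scd) Scd.
Qed.

Lemma cls_eq c d : cls F c = cls F d <-> Sigma F (eqc c d).
Proof.
split=> [e|Scd].
  suff : cls F c d by [].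
  by rewrite e; apply: Sigma_refl.
apply/seteqP; split=> e /= Se; last exact: Sigma_trans Scd Se.
exact: Sigma_trans (Sigma_sym Scd) Se.
Qed.

Lemma icst_eq c d : icst (AF L C F) c = icst (AF L C F) d <-> Sigma F (eqc c d).
Proof. by rewrite -cls_eq; split=> [/(congr1 sval)|e] //; apply: eq_exist. Qed.

Lemma icst_surj (a : dom (AF L C F)) : exists c, icst (AF L C F) c = a.
Proof. by case: a => X rX; have [c _ e] := rX; exists c; apply: eq_exist. Qed.

(** By (Str.3) and genericity every class has a representative in [C]. *)
Lemma range_cls :
  range (fun a : dom (AF L C F) => sval a) = [set cls F c | c in [set c | sval c ∈ C]].
Proof.
apply/seteqP; split=> [_ [a _ <-]|_ [c _ <-]]; last by exists (icst (AF L C F) c).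
have [d <-] := icst_surj a; have [c [cC Scd]] := Sigma_str3 d.
by exists c => //; apply/cls_eq.
Qed.

(** (Str.2) replaces one argument at a time. Those already replaced accumulate in [pre], and
    variable 0 marks the current place. *)
Lemma Sigma_rel (R : V) (pre cs cs' : seq (csym LC)) : R ∈ rels LC ->
  opair R (num (size (pre ++ cs))) ∈ arity LC -> map (cls F) cs = map (cls F) cs' ->
  Sigma F (rel_code R (map (@tcst _ LC) (pre ++ cs))) ->
  Sigma F (rel_code R (map (@tcst _ LC) (pre ++ cs'))).
Proof.
move=> RL; elim: cs cs' pre => [|c cs IH] [|c' cs'] //= pre Rar [/cls_eq/Sigma_sym Sc ecs] SR.
rewrite -cat_rcons; apply: IH => //; rewrite cat_rcons.
  by move: Rar; rewrite !size_cat.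
pose ts := map (@tcst _ LC) pre ++ tvar LC 0 :: map (@tcst _ LC) cs.
have tar : opair R (num (size ts)) ∈ arity LC.
  by move: Rar; rewrite !size_cat /= !size_map.
have tc (d : csym LC) (es : seq (csym LC)) :
    map (tsubst (inst1 0 d)) (map (@tcst _ LC) es) = map (@tcst _ LC) es.
  by rewrite -map_comp.
have tsE d : map (tsubst (inst1 0 d)) ts = map (@tcst _ LC) (pre ++ d :: cs).
  by rewrite /ts !map_cat /= !tc.
have := @Sigma_replace c' c (@Form V LC _ (Prel RL tar) I) 0.
rewrite /subst /= !tsE; apply=> // n; rewrite /fv /= /ts.
have nocst (es : seq (csym LC)) : ~ List.In (tvar LC n) (map (@tcst _ LC) es).
  by elim: es => //= e es IHes [].
by elim: (pre) => [[[<-]//|/nocst]|d es IHes []].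
Qed.

End Generic.

(** * Moving a negation inside, computed from the code alone *)

Section NegIn.
Variables (V : groundModel) (L : signature V).
Implicit Types (x y W X : V).

Lemma im_negP X y : y ∈ im (@neg_code V) X <-> exists x, x ∈ X /\ y = neg_code x.
Proof.
rewrite (setofP (P := (@neg_code V) @` ext X)).
  by split=> [[x xX <-]|[x [xX ->]]]; exists x.
have [||Y YP] := @replacement V (fun e => e 1 = ktag 2 (e 0)) (fun _ => X) X.
- by dfn_auto.
- by move=> x z z' _ /= -> ->.
exists Y => z; rewrite YP /=.
by split=> [[x [xX ->]]|[x xX <-]]; exists x.
Qed.

Local Ltac code_cases d :=
  case: d => [R ts ? ?|t u|z ?|Z ?|Z ?|W' z ? ?|W' z ? ?] /ktag_inj[] // _ /=.

(** The shape of the code enters as an equation because [preform] is indexed by elements of V: case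
    analysis on [d] is followed by injectivity of tags, which excludes the other constructors. *)
Lemma preneg_in_neg x y (d : preform L x) : x = neg_code y -> preneg_in d = y.
Proof. by code_cases d => ->. Qed.

Lemma preneg_in_and x X (d : preform L x) :
  x = and_code X -> preneg_in d = or_code (im (@neg_code V) X).
Proof. by code_cases d => ->. Qed.

Lemma preneg_in_or x X (d : preform L x) :
  x = or_code X -> preneg_in d = and_code (im (@neg_code V) X).
Proof. by code_cases d => ->. Qed.

Lemma preneg_in_all x W y (d : preform L x) :
  x = all_code W y -> preneg_in d = ex_code W (neg_code y).
Proof. by code_cases d => /opair_inj[-> ->]. Qed.

Lemma preneg_in_ex x W y (d : preform L x) :
  x = ex_code W y -> preneg_in d = all_code W (neg_code y).
Proof. by code_cases d => /opair_inj[-> ->]. Qed.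

End NegIn.

(** * Truth in the term structure *)

Section Truth.
Variables (V : groundModel) (L : signature V) (C S : V) (F : set V).
Local Notation LC := (addC L C).
Local Notation A := (AF L C F).
Hypothesis S_cp : consistency_property L C S.
Hypothesis F_generic : generic (PS S) (@lePS V) F.
Implicit Types (x y W X : V) (s : nat -> option (csym LC)) (rho : nat -> dom A).

Lemma presubst_form x (d : preform LC x) s : finite_support s -> finfree d ->
  exists phi : form LC, presubst d s = phi /\
    forall s', finite_support s' -> subst phi s' = presubst d (scomp s s').
Proof.
move=> sfin /(presubst_tree sfin)[d' [ffd _ e]].
by exists (Form ffd).
Qed.

Lemma Sigma_presubst_neg x (d : preform LC x) s : finite_support s -> finfree d ->
  Sigma F (neg_code (presubst d s)) ->
  exists d' : preform LC (presubst d s), Sigma F (preneg_in d').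
Proof.
move=> sfin /(presubst_tree sfin)[d' [ffd _ _]] Sn; exists d'.
exact: (Sigma_neg_in S_cp F_generic (phi := Form ffd) Sn).
Qed.

Definition assigns s rho := forall n c, s n = Some c -> rho n = icst A c.

Lemma term_value s rho (t : term LC) : assigns s rho ->
  (forall n, t = tvar LC n -> s n <> None) ->
  exists c, tsubst s t = tcst c /\ teval rho t = icst A c.
Proof.
move=> srho; case: t => [n|c] tdom /=; last by exists c.
by case sn: (s n) (tdom n erefl) => [c|] // _; exists c; rewrite (srho n c).
Qed.

Lemma terms_value s rho (ts : seq (term LC)) : assigns s rho ->
  (forall n, List.In (tvar LC n) ts -> s n <> None) ->
  exists cs, map (tsubst s) ts = map (@tcst _ LC) cs /\
    map (teval rho) ts = map (icst A) cs.
Proof.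
move=> srho; elim: ts => [|t ts IH] tdom /=; first by exists [::].
have [n tn|c [-> ->]] := @term_value s rho t srho; first by apply: tdom; left.
have [n tn|cs [-> ->]] := IH; first by apply: tdom; right.
by exists (c :: cs).
Qed.

(** The negative half is carried along because the induction step for a negation consumes it, and
    moving negations inside reduces it to subformulae. *)
Definition decides s rho x (d : preform LC x) :=
  (Sigma F (presubst d s) -> sat d rho) /\
  (Sigma F (neg_code (presubst d s)) -> ~ sat d rho).

Lemma decides_rel (R : V) ts (Rr : R ∈ rels LC)
    (Ra : opair R (num (size ts)) ∈ arity LC) s rho : assigns s rho ->
  (forall n, List.In (tvar LC n) ts -> s n <> None) ->
  decides s rho (Prel Rr Ra).
Proof.
move=> srho /(terms_value srho)[cs [tcs ecs]].
have clsE (es : seq (csym LC)) : map sval (map (icst A) es) = map (cls F) es.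
  by rewrite -map_comp.
rewrite /decides /= tcs ecs; split=> [SR|SnR [cs' []]].
  by exists cs; rewrite clsE.
rewrite clsE => e SR.
have size_cs : size cs = size ts by rewrite -(size_map (tsubst s)) tcs size_map.
have size_cs' : size cs' = size ts.
  by rewrite -(size_map (cls F)) -e size_map.
(* Satisfaction only yields representatives [cs'] of the same classes; they are exchanged for [cs]
   to contradict (Con). *)
have {}SR : Sigma F (rel_code R (map (@tcst _ LC) cs)).
  apply: (@Sigma_rel _ _ _ _ _ S_cp F_generic R [::] cs' cs) => //=.
  by rewrite size_cs'.
have Ra' : opair R (num (size (map (@tcst _ LC) cs))) ∈ arity LC.
  by rewrite size_map size_cs.
exact: (Sigma_con S_cp F_generic (phi := @Form V LC _ (Prel Rr Ra') I) SR SnR).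
Qed.

Lemma decides_eq (t u : term LC) s rho : assigns s rho ->
  (forall n, t = tvar LC n \/ u = tvar LC n -> s n <> None) ->
  decides s rho (Defs.Peq t u).
Proof.
move=> srho tudom.
have [n tn|c [tc tv]] := term_value (t := t) srho; first by apply: tudom; left.
have [n un|d [ud uv]] := term_value (t := u) srho; first by apply: tudom; right.
rewrite /decides /= tc ud tv uv (icst_eq S_cp F_generic); split=> // Sn Scd.
exact: (Sigma_con S_cp F_generic
  (phi := @Form V LC _ (Defs.Peq (tcst c) (tcst d)) I) Scd Sn).
Qed.

Lemma decides_neg x (d : preform LC x) s rho : finite_support s -> finfree d ->
  decides s rho d -> decides s rho (Pneg d).
Proof.
move=> sfin ffd [IH1 IH2]; split=> //= Snn.
have [d' Sd'] := Sigma_presubst_neg (d := Pneg d) sfin ffd Snn.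
by move: Sd'; rewrite (preneg_in_neg d' erefl) => /IH1 sd /(_ sd).
Qed.

Lemma decides_and X (f : forall x, x ∈ X -> preform LC x) s rho :
  finite_support s -> finfree (Pand f) ->
  (forall x h, decides s rho (f x h)) -> decides s rho (Pand f).
Proof.
move=> sfin ff IH; have YP := presubst_imageP f sfin.
split=> [SY x h|Sn] /=.
  by apply: (IH x h).1; apply: (Sigma_and S_cp F_generic SY); apply/YP; exists x, h.
(* The negated conjunction gives the disjunction of the negations, from which (Ind.4) selects a
   refuted conjunct. *)
have [d' Sd'] := Sigma_presubst_neg sfin ff Sn.
move: Sd'; rewrite (preneg_in_and d' erefl).
move=> /(Sigma_or S_cp F_generic)[z [/im_negP[y [/YP[x [h ->]] ->]] Sx]] /(_ x h).
exact: (IH x h).2.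
Qed.

Lemma decides_or X (f : forall x, x ∈ X -> preform LC x) s rho :
  finite_support s -> finfree (Por f) ->
  (forall x h, decides s rho (f x h)) -> decides s rho (Por f).
Proof.
move=> sfin ff IH; have YP := presubst_imageP f sfin.
split=> [/= /(Sigma_or S_cp F_generic)[y [/YP[x [h ->]] Sx]]|Sn [x [h]] /=].
  by exists x, h; apply: (IH x h).1.
apply: (IH x h).2; have [d' Sd'] := Sigma_presubst_neg sfin ff Sn.
move: Sd'; rewrite (preneg_in_or d' erefl) => Sa.
apply: (Sigma_and S_cp F_generic Sa); apply/im_negP; exists (presubst (f x h) s).
by split=> //; apply/YP; exists x, h.
Qed.

(** The outer substitution passes under a quantifier over [W], hence is masked there, and the bound
    variables are then instantiated by [c]. *)
Definition extend W s (c : nat -> csym LC) := scomp (Defs.mask W s) (inst W c).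

Lemma extend_in W s c n : num n ∈ W -> extend W s c n = Some (c n).
Proof.
by move=> nW; rewrite /extend /scomp /Defs.mask /inst; case: ifPn => /asboolP.
Qed.

Lemma extend_notin W s c n : ~ num n ∈ W -> extend W s c n = s n.
Proof.
move=> nW; rewrite /extend /scomp /Defs.mask /inst.
by case: ifPn => /asboolP // _; case: (s n).
Qed.

Lemma extend_support W s c :
  varset W -> finite_support s -> finite_support (extend W s c).
Proof.
by move=> Wv sfin; apply: scomp_support; [exact: mask_support|exact: inst_support].
Qed.

Lemma extend_dom W s c (P : set nat) : (forall n, P n /\ ~ num n ∈ W -> s n <> None) ->
  forall n, P n -> extend W s c n <> None.
Proof.
move=> sP n Pn; case: (EM (num n ∈ W)) => nW; first by rewrite extend_in.
by rewrite extend_notin //; apply: sP.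
Qed.

Lemma extend_assigns W s c rho rho' : assigns s rho ->
  (forall n, ~ num n ∈ W -> rho' n = rho n) ->
  (forall n, num n ∈ W -> rho' n = icst A (c n)) -> assigns (extend W s c) rho'.
Proof.
move=> srho out inW n d; case: (EM (num n ∈ W)) => nW.
  by rewrite extend_in // inW // => -[->].
by rewrite extend_notin // out //; apply: srho.
Qed.

(** Uniformity in [s] and [rho] is needed because a quantifier changes both. *)
Definition decided x (d : preform LC x) := forall s rho, finite_support s ->
  assigns s rho -> (forall n, free d n -> s n <> None) -> decides s rho d.

Section Quantifiers.
Variables (W x : V) (d : preform LC x) (s : nat -> option (csym LC)) (rho : nat -> dom A).
Hypotheses (Wv : varset W) (ffd : finfree d) (IH : decided d).
Hypotheses (sfin : finite_support s) (srho : assigns s rho).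
Hypothesis sdom : forall n, free d n /\ ~ num n ∈ W -> s n <> None.

Lemma decides_extend c rho' : (forall n, ~ num n ∈ W -> rho' n = rho n) ->
  (forall n, num n ∈ W -> rho' n = icst A (c n)) -> decides (extend W s c) rho' d.
Proof.
move=> out inW; apply: IH.
- exact: extend_support.
- exact: extend_assigns out inW.
- exact: extend_dom.
Qed.

(** (Ind.3) applies to the masked formula repackaged as a [form]; its instances are then recomputed
    on the tree [d]. *)
Lemma Sigma_all_extend c : Sigma F (all_code W (presubst d (Defs.mask W s))) ->
  Sigma F (presubst d (extend W s c)).
Proof.
have [phi [e sub]] := presubst_form (mask_support W sfin) ffd.
rewrite e /extend -sub; last exact: inst_support.
exact: (Sigma_all S_cp F_generic).
Qed.

Lemma Sigma_all_neg_extend c :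
  Sigma F (all_code W (neg_code (presubst d (Defs.mask W s)))) ->
  Sigma F (neg_code (presubst d (extend W s c))).
Proof.
have [phi [e sub]] := presubst_form (mask_support W sfin) ffd.
rewrite e /extend -sub; last exact: inst_support.
exact: (Sigma_all S_cp F_generic (phi := @Form V LC _ (Pneg (ftree phi)) (ffin phi))).
Qed.

Lemma Sigma_ex_extend : Sigma F (ex_code W (presubst d (Defs.mask W s))) ->
  exists c, Sigma F (presubst d (extend W s c)).
Proof.
have [phi [e sub]] := presubst_form (mask_support W sfin) ffd.
rewrite e => /(Sigma_ex S_cp F_generic Wv)[c Sc]; exists c.
by rewrite /extend -sub //; apply: inst_support.
Qed.

Lemma Sigma_ex_neg_extend :
  Sigma F (ex_code W (neg_code (presubst d (Defs.mask W s)))) ->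
  exists c, Sigma F (neg_code (presubst d (extend W s c))).
Proof.
have [phi [e sub]] := presubst_form (mask_support W sfin) ffd.
pose nphi := @Form V LC _ (Pneg (ftree phi)) (ffin phi).
rewrite e => /(Sigma_ex S_cp F_generic (phi := nphi) Wv)[c Sc]; exists c.
by rewrite /extend -sub //; apply: inst_support.
Qed.

(** Every element of the term structure is the value of a constant, so instances by constants
    exhaust the assignments a quantifier ranges over. *)
Lemma named_values (rho' : nat -> dom A) :
  exists c : nat -> csym LC, forall n, rho' n = icst A (c n).
Proof.
have rP n : exists c, rho' n = icst A c.
  by have [c <-] := icst_surj (rho' n); exists c.
by have [c cP] := choice rP; exists c.
Qed.

Definition revalue (c : nat -> csym LC) n : dom A :=
  if `[< num n ∈ W >] then icst A (c n) else rho n.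

Lemma decides_revalue c : decides (extend W s c) (revalue c) d.
Proof.
by apply: decides_extend => n nW; rewrite /revalue; case: ifPn => /asboolP.
Qed.

Lemma revalue_out c n : ~ num n ∈ W -> revalue c n = rho n.
Proof. by rewrite /revalue; case: ifPn => /asboolP. Qed.

Lemma decides_all : decides s rho (Pall Wv d).
Proof.
split=> [/= Sa rho' out|Sn sd].
  have [c cP] := named_values rho'.
  by apply: (decides_extend (c := c) out _).1; [|exact: Sigma_all_extend].
(* The constants obtained for the existential form of the negation name a counterexample,
   [revalue c]. *)
have [d' Sd'] := Sigma_presubst_neg (d := Pall Wv d) sfin ffd Sn.
move: Sd'; rewrite (preneg_in_all d' erefl) => /Sigma_ex_neg_extend[c Sc].
by apply: (decides_revalue c).2 Sc _; apply: sd => n; apply: revalue_out.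
Qed.

Lemma decides_ex : decides s rho (Pex Wv d).
Proof.
split=> [/= /Sigma_ex_extend[c Sc]|Sn [rho' [out]]].
  exists (revalue c); split; first by move=> n; apply: revalue_out.
  exact: (decides_revalue c).1.
have [d' Sd'] := Sigma_presubst_neg (d := Pex Wv d) sfin ffd Sn.
move: Sd'; rewrite (preneg_in_ex d' erefl) => Sa.
have [c cP] := named_values rho'.
by apply: (decides_extend (c := c) out _).2; [|exact: Sigma_all_neg_extend].
Qed.

End Quantifiers.

Lemma decided_finfree x (d : preform LC x) : finfree d -> decided d.
Proof.
elim: d => {x} [R ts Rr Ra|t u|x d IH|X f IH|X f IH|W x Wv d IH|W x Wv d IH] ffd
  s rho sfin srho sdom.
- exact: decides_rel.
- exact: decides_eq.
- by apply: decides_neg => //; apply: IH.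
- apply: decides_and => // x h; apply: IH => //; first exact: ffd.2.
  by move=> n fn; apply: sdom; exists x, h.
- apply: decides_or => // x h; apply: IH => //; first exact: ffd.2.
  by move=> n fn; apply: sdom; exists x, h.
- by apply: decides_all => //; apply: IH.
- by apply: decides_ex => //; apply: IH.
Qed.

Lemma Sigma_models (psi : form LC) : sentence psi -> Sigma F psi -> models A psi.
Proof.
move=> closed Spsi rho.
(* A sentence has no free variable to close, so the empty substitution is admissible, and it leaves
   the code unchanged. *)
have [] // := @decided_finfree _ (ftree psi) (ffin psi) (fun _ => None) rho.
- by exists 0.
- by move=> n; rewrite -/(fv psi) closed.
- by rewrite presubst_none => sp _; apply: sp.
Qed.

End Truth.

Theorem theorem5p7 (V : groundModel) (L : signature V) (C S : V) (F : set V)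
    (C_infinite : infinite_set (ext C))
    (C_disjoint : ext C `&` (ext (rels L) `|` ext (csts L)) = set0)
    (S_consistency : consistency_property L C S)
    (S_finite : forall s : V, s ∈ S -> finite_set (ext s))
    (F_generic : generic (PS S) (@lePS V) F) :
  range (fun a : dom (AF L C F) => sval a)
    = [set cls F c | c in [set c : csym (addC L C) | sval c ∈ C]]
  /\ forall psi : form (addC L C), sentence psi ->
       Sigma F psi -> models (AF L C F) psi.
Proof.
split; first exact: (range_cls S_consistency F_generic).
by move=> psi; apply: (Sigma_models S_consistency F_generic).
Qed.
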